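(* Let $A\subseteq B$ be a $C^*$-inclusion. If $A\subseteq B$ has the almost extension property, then it is aperiodic. If $B$ is separable, then $A\subseteq B$ is aperiodic if and only if $A\subseteq B$ has the almost extension property.
   Context: A $C^*$-inclusion $A\subseteq B$ means that $A$ is a $C^*$-subalgebra of the $C^*$-algebra $B$. It is aperiodic if for every $x\in B$, every non-zero hereditary $C^*$-subalgebra $D\subseteq A$ and every $\varepsilon>0$ there are $a\in D$ with $a\ge0$, $\|a\|=1$ and $y\in A$ with $\|axa-y\|<\varepsilon$. Let $P(A)$ be the set of pure states of $A$ and let $P_1(A\uparrow B)$ be the set of all pure states on $A$ that extend uniquely to a state on $B$. The inclusion has the almost extension property if $P_1(A\uparrow B)$ is weak-$*$-dense in $P(A)$. *)

(* Defs.v *)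
From HB Require Import structures.
From mathcomp Require Import all_boot all_order all_algebra.
From mathcomp Require Import complex.
From mathcomp Require Import all_classical all_reals all_analysis.

Set Implicit Arguments.
Unset Strict Implicit.
Unset Printing Implicit Defensive.

Import Order.TTheory GRing.Theory Num.Theory.
Import numFieldNormedType.Exports.

Local Open Scope classical_set_scope.
Local Open Scope complex_scope.
Local Open Scope ring_scope.

Reserved Notation "x ** y" (at level 40, left associativity).

(* C*-algebras need not be unital, so the ring structures of the library, which
   all have a unit, do not apply. *)
HB.mixin Record CompleteNormedModule_isCStarAlgebra (R : realType) B
    of CompleteNormedModule R[i] B := {
  cmul : B -> B -> B;
  star : B -> B;
  cmulA : associative cmul;
  cmulDl : left_distributive cmul +%R;
  cmulDr : right_distributive cmul +%R;
  cmulZl : forall (c : R[i]) (x y : B), cmul (c *: x) y = c *: cmul x y;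
  cmulZr : forall (c : R[i]) (x y : B), cmul x (c *: y) = c *: cmul x y;
  starK : involutive star;
  starD : {morph star : x y / x + y};
  starZ : forall (c : R[i]) (x : B), star (c *: x) = c^* *: star x;
  starM : forall x y : B, star (cmul x y) = cmul (star y) (star x);
  cnormM : forall x y : B, `|cmul x y| <= `|x| * `|y|;
  cnorm_star : forall x : B, `|cmul (star x) x| = `|x| ^+ 2
}.

#[short(type="cstarAlgType")]
HB.structure Definition CStarAlgebra (R : realType) :=
  {B of CompleteNormedModule R[i] B & CompleteNormedModule_isCStarAlgebra R B}.

Notation "x ** y" := (cmul x y) : ring_scope.

Record csubalg (R : realType) (B : cstarAlgType R) := CSubalg {
  carrier : set B;
  csub0 : carrier 0;
  csubD : forall x y, carrier x -> carrier y -> carrier (x + y);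
  csubZ : forall (c : R[i]) x, carrier x -> carrier (c *: x);
  csubM : forall x y, carrier x -> carrier y -> carrier (x ** y);
  csubS : forall x, carrier x -> carrier (star x);
  csub_closed : closed carrier
}.

Definition csub_type (R : realType) (B : cstarAlgType R) (A : csubalg B) :=
  {x : B | x \in carrier A}.

Section CSubalgebraIsCStarAlgebra.
Context (R : realType) (B : cstarAlgType R) (A : csubalg B).
Local Notation T := (csub_type A).

HB.instance Definition _ := [isSub of T for @sval B _].
HB.instance Definition _ := [Choice of T by <:].

Let csub_submod : submod_closed (mem (carrier A)).
Proof.
split; first by apply/mem_set/csub0.
by move=> c x y /set_mem Ax /set_mem Ay; apply/mem_set/csubD => //; exact: csubZ.
Qed.

HB.instance Definition _ :=
  GRing.SubChoice_isSubLmodule.Build R[i] B (mem (carrier A)) T csub_submod.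

Let snorm (x : T) : R[i] := `|val x|.

Let snormD x y : snorm (x + y) <= snorm x + snorm y.
Proof. by rewrite /snorm linearD ler_normD. Qed.

Let snormZ (c : R[i]) x : snorm (c *: x) = `|c| * snorm x.
Proof. by rewrite /snorm linearZ normrZ. Qed.

Let snorm0 x : snorm x = 0 -> x = 0.
Proof. by move=> /normr0_eq0 x0; apply: val_inj; rewrite x0 linear0. Qed.

HB.instance Definition _ := Lmodule_isNormed.Build R[i] T snormD snormZ snorm0.

Lemma csub_normE (x : T) : `|x| = `|val x|.
Proof. by []. Qed.

Let csub_complete (F : set_system T) : ProperFilter F -> cauchy F -> cvg F.
Proof.
move=> FF cF.
have cvF : cvg ((val : T -> B) @ F).
  apply: cauchy_cvg; apply/cauchy_ballP => e e0.
  move/cauchy_ballP : cF => /(_ e e0) [[P Q] [/= FP FQ] PQ].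
  exists (val @` P, val @` Q).
    by split => /=; [apply: filterS FP|apply: filterS FQ] => x ? ; exists x.
  move=> [_ _] [/= [x Px <-] [y Qy <-]].
  by have := PQ (x, y) (conj Px Qy); rewrite /= -!ball_normE /= csub_normE linearB.
have Al : carrier A (lim (val @ F)).
  apply: (closed_cvg (carrier A) _ _ _ cvF); first exact: csub_closed.
  by near=> x; exact/set_mem/(valP x).
apply/cvg_ex; exists (Sub (lim (val @ F)) (mem_set Al) : T).
apply/cvgrPdist_lt => e e0.
move/cvgrPdist_lt : cvF => /(_ e e0); apply: filterS => x.
by rewrite csub_normE linearB.
Unshelve. all: by end_near. Qed.

HB.instance Definition _ := Uniform_isComplete.Build T csub_complete.

Lemma csubP (x : T) : carrier A (val x).
Proof. exact/set_mem/(valP x). Qed.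

Let smul (x y : T) : T := Sub (val x ** val y) (mem_set (csubM (csubP x) (csubP y))).
Let sstar (x : T) : T := Sub (star (val x)) (mem_set (csubS (csubP x))).

Let smulA : associative smul.
Proof. by move=> x y z; apply: val_inj; rewrite !SubK cmulA. Qed.
Let smulDl : left_distributive smul +%R.
Proof. by move=> x y z; apply: val_inj; rewrite !(SubK, linearD) cmulDl. Qed.
Let smulDr : right_distributive smul +%R.
Proof. by move=> x y z; apply: val_inj; rewrite !(SubK, linearD) cmulDr. Qed.
Let smulZl (c : R[i]) x y : smul (c *: x) y = c *: smul x y.
Proof. by apply: val_inj; rewrite !(SubK, linearZ) cmulZl. Qed.
Let smulZr (c : R[i]) x y : smul x (c *: y) = c *: smul x y.
Proof. by apply: val_inj; rewrite !(SubK, linearZ) cmulZr. Qed.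
Let sstarK : involutive sstar.
Proof. by move=> x; apply: val_inj; rewrite !SubK starK. Qed.
Let sstarD : {morph sstar : x y / x + y}.
Proof. by move=> x y; apply: val_inj; rewrite !(SubK, linearD) starD. Qed.
Let sstarZ (c : R[i]) x : sstar (c *: x) = c^* *: sstar x.
Proof. by apply: val_inj; rewrite !(SubK, linearZ) starZ. Qed.
Let sstarM x y : sstar (smul x y) = smul (sstar y) (sstar x).
Proof. by apply: val_inj; rewrite !SubK starM. Qed.
Let snormM (x y : T) : `|smul x y| <= `|x| * `|y|.
Proof. exact: cnormM. Qed.
Let snorm_star (x : T) : `|smul (sstar x) x| = `|x| ^+ 2.
Proof. exact: cnorm_star. Qed.

HB.instance Definition _ := CompleteNormedModule_isCStarAlgebra.Build R T
  smulA smulDl smulDr smulZl smulZr sstarK sstarD sstarZ sstarM snormM snorm_star.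

End CSubalgebraIsCStarAlgebra.

Definition csub_alg (R : realType) (B : cstarAlgType R) (A : csubalg B)
  : cstarAlgType R := csub_type A.
Coercion csub_alg : csubalg >-> CStarAlgebra.type.

Definition csub_incl (R : realType) (B : cstarAlgType R) (A : csubalg B) : A -> B :=
  fun a => \val (a : csub_type A).

Section CStarNotions.
Context (R : realType).
Implicit Types A B : cstarAlgType R.

Definition positive A (a : A) := exists b : A, a = star b ** b.

Definition hereditary A (D : csubalg A) :=
  forall a d : A, carrier D d -> positive a -> positive (d - a) -> carrier D a.

(* The norm of a normed module over R[i] takes its values in R[i]; they are
   real, so Re loses nothing. *)
Definition functional_norm A (f : A -> R[i]) : \bar R :=
  ereal_sup [set (complex.Re `|f a|)%:E | a in [set a : A | `|a| <= 1]].

Definition state A : set (A -> R[i]) :=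
  [set f | [/\ scalar f, forall a : A, positive a -> 0 <= f a
             & functional_norm f = 1%E]].

Definition pure_state A : set (A -> R[i]) :=
  [set f | state f /\
    forall (g h : A -> R[i]) (t : R), state g -> state h -> 0 < t < 1 ->
      (forall a, f a = t%:C * g a + (1 - t)%:C * h a) -> g = f /\ h = f].

Definition unique_ext_pure_state B (A : csubalg B) : set (A -> R[i]) :=
  [set f | pure_state f /\
    exists! g : B -> R[i], state g /\ forall a : A, g (csub_incl a) = f a].

(* The weak-* topology is the restriction of the topology of pointwise
   convergence to the bounded linear functionals. *)
Definition almost_extension_property B (A : csubalg B) :=
  @pure_state A `<=` closure (@unique_ext_pure_state B A : set {ptws A -> R[i]^o}).

Definition aperiodic B (A : csubalg B) :=
  forall (x : B) (D : csubalg A), hereditary D ->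
    (exists2 d : A, carrier D d & d != 0) ->
  forall e : R, 0 < e ->
  exists a y : A, [/\ carrier D a, positive a, `|a| = 1 &
    `|csub_incl a ** x ** csub_incl a - csub_incl y| < e%:C].

End CStarNotions.

Definition separable (T : topologicalType) :=
  exists2 S : set T, countable S & dense S.

(* Main.v *)
(* Everything takes place in unitizations, where a state of A becomes a positive
   functional with value 1 at 1 and where positive and negative parts of shifted
   self-adjoint elements replace the functional calculus.

   Almost extension property => aperiodic. Let phi extend uniquely, and let d >= 0
   be in D with phi(d) bounded below. By Hahn-Banach, uniqueness gives
   self-adjoint w, z in the unitization of A with 0 <= w - dxd <= z and phi(z)
   small (for dxd self-adjoint). A spectral cutoff h of z makes hzh small while
   phi(1 - h) stays small, so b = dhd, which is in D, is bounded below in norm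
   and bxb is close to d(hwh)d.

   Aperiodic + separable => almost extension property. Purity of phi0 enters
   through the identity inf {phi0(h) | h >= 0, h >= g} = max(0, phi0(g)), which
   traps a weak-* neighbourhood of phi0 by a single n >= 0: every state vanishing
   at n is in the neighbourhood. Starting from n, apply aperiodicity inside the
   annihilator of s_k to the k-th element of a dense sequence to get b_k, and add
   to s_k the negative part of b_k - (1 - e_k). The states vanishing at all s_k
   form a nonempty face, so one of them is pure; it is almost 1 at each b_k, so
   its extensions agree on the dense sequence. Extreme points of such faces come
   from Zorn's lemma applied to sublinear functionals, which yields Hahn-Banach
   and Krein-Milman at once and avoids any compactness or Baire argument. *)
From HB Require Import structures.
From mathcomp Require Import all_boot all_order all_algebra.
From mathcomp Require Import complex.
From mathcomp Require Import all_classical all_reals all_analysis.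
From mathcomp Require Import ring lra.
Require Import Defs.

Set Implicit Arguments.
Unset Strict Implicit.
Unset Printing Implicit Defensive.

Import Order.TTheory GRing.Theory Num.Theory.
Import numFieldNormedType.Exports.

Local Open Scope classical_set_scope.
Local Open Scope ring_scope.

(** * Unital C*-algebras *)

(** Scalars and norm are real, so that estimates take place in [R]; the complex structure survives
    as the central skew-adjoint element [ii] of square -1. *)
HB.mixin Record Algebra_isUnitalCStar (R : realType) U of GRing.Algebra R U := {
  nrm : U -> R;
  adj : U -> U;
  ii : U;
  nrmD : forall x y, nrm (x + y) <= nrm x + nrm y;
  nrmZ : forall t x, nrm (t *: x) = `|t| * nrm x;
  nrm0_eq0 : forall x, nrm x = 0 -> x = 0;
  nrmM : forall x y, nrm (x * y) <= nrm x * nrm y;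
  nrm_adjM : forall x, nrm (adj x * x) = nrm x ^+ 2;
  nrm_complete : forall u : nat -> U,
    (forall e, 0 < e -> exists N, forall n, (N <= n)%N -> nrm (u n - u N) < e) ->
    exists l, forall e, 0 < e -> exists N, forall n, (N <= n)%N -> nrm (u n - l) < e;
  adjK : involutive adj;
  adjD : {morph adj : x y / x + y};
  adjZ : forall t x, adj (t *: x) = t *: adj x;
  adjM : forall x y, adj (x * y) = adj y * adj x;
  iiC : forall x, ii * x = x * ii;
  iiii : ii * ii = - 1;
  adj_ii : adj ii = - ii
}.

#[short(type="ucstarType")]
HB.structure Definition UnitalCStar (R : realType) :=
  {U of GRing.Algebra R U & Algebra_isUnitalCStar R U}.

Section UnitalCStarTheory.
Context (R : realType) (U : ucstarType R).
Implicit Types x y z a b c : U.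

Lemma adj0 : adj (0 : U) = 0.
Proof. by apply: (addrI (adj 0)); rewrite -adjD !addr0. Qed.

Lemma adjN x : adj (- x) = - adj x.
Proof. by apply: (addrI (adj x)); rewrite -adjD !subrr adj0. Qed.

Lemma adjB x y : adj (x - y) = adj x - adj y.
Proof. by rewrite adjD adjN. Qed.

Lemma adj1 : adj (1 : U) = 1.
Proof. by rewrite -[LHS]mul1r -{1}[1]adjK -adjM mul1r adjK. Qed.

Lemma adjA t : adj (t%:A : U) = t%:A.
Proof. by rewrite adjZ adj1. Qed.

Lemma nrm0 : nrm (0 : U) = 0.
Proof. by rewrite -(scale0r (0 : U)) nrmZ normr0 mul0r. Qed.

Lemma nrmN x : nrm (- x) = nrm x.
Proof. by rewrite -scaleN1r nrmZ normrN1 mul1r. Qed.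

Lemma nrmC x y : nrm (x - y) = nrm (y - x).
Proof. by rewrite -nrmN opprB. Qed.

Lemma nrm_ge0 x : 0 <= nrm x.
Proof. by have := nrmD x (- x); rewrite subrr nrm0 nrmN; lra. Qed.

Lemma nrmB x y : nrm (x - y) <= nrm x + nrm y.
Proof. by rewrite -(nrmN y) nrmD. Qed.

Lemma nrm_triangle z x y : nrm (x - y) <= nrm (x - z) + nrm (z - y).
Proof. by have := nrmD (x - z) (z - y); rewrite addrA subrK. Qed.

Lemma nrm1_le1 : nrm (1 : U) <= 1.
Proof.
have := nrm_adjM (1 : U); rewrite adj1 mulr1 expr2 => h.
have [e|e] := eqVneq (nrm (1 : U)) 0; first by rewrite e ler01.
have := mulfI e (etrans (esym h) (esym (mulr1 _))) => ->; exact: lexx.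
Qed.

Lemma nrmA t : nrm (t%:A : U) <= `|t|.
Proof. by rewrite nrmZ ler_piMr ?nrm1_le1. Qed.

Lemma nrm_adj x : nrm (adj x) = nrm x.
Proof.
suff le y : nrm y <= nrm (adj y) by apply/le_anti; rewrite -{2}(adjK x) !le.
have [->|y0] := eqVneq (nrm y) 0; first exact: nrm_ge0.
have y_gt0 : 0 < nrm y by rewrite lt_def y0 nrm_ge0.
by rewrite -(ler_pM2r y_gt0) -expr2 -nrm_adjM nrmM.
Qed.

Lemma nrm_sqr x : adj x = x -> nrm (x * x) = nrm x ^+ 2.
Proof. by move=> xs; rewrite -{1}xs nrm_adjM. Qed.

Lemma sqr_eq0 x : adj x = x -> x * x = 0 -> x = 0.
Proof.
move=> xs x0; apply: nrm0_eq0; apply/eqP.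
by rewrite -sqrf_eq0 -nrm_sqr // x0 nrm0.
Qed.

Lemma adjM_eq0 x : adj x * x = 0 -> x = 0.
Proof.
move=> x0; apply: nrm0_eq0; apply/eqP.
by rewrite -sqrf_eq0 -nrm_adjM x0 nrm0.
Qed.

Lemma nrm_small x K : (forall e, 0 < e -> nrm x <= K * e) -> x = 0.
Proof.
move=> h; apply: nrm0_eq0; apply/le_anti/andP; split; last exact: nrm_ge0.
have K0 : 0 <= K by have := h 1 ltr01; have := nrm_ge0 x; lra.
apply/ler_addgt0Pl => e e0; rewrite addr0.
have K1 : 0 < K + 1 by lra.
apply: (le_trans (h _ (divr_gt0 e0 K1))).
rewrite mulrCA ger_pMr // ler_pdivrMr // mul1r; lra.
Qed.

(* [1 - sqrt (1 - c)] is the fixed point of [y = (c + y ^ 2) / 2]; the increments of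
   this iteration are bounded by those of the scalar iteration at [c = 1]. *)
Fixpoint sqrt_iter c n : U :=
  if n is m.+1 then 2^-1 *: (c + sqrt_iter c m * sqrt_iter c m) else 0.

Fixpoint sqrt_majorant n : R :=
  if n is m.+1 then 2^-1 * (1 + sqrt_majorant m ^+ 2) else 0.

Lemma sqrt_majorant_bound n :
  0 <= sqrt_majorant n <= 1 /\ sqrt_majorant n <= sqrt_majorant n.+1.
Proof.
elim: n => [|n [/andP[h0 h1] h2]] /=; first by rewrite expr0n /=; split; lra.
move: h0 h1 h2 => /=; set e := sqrt_majorant n => h0 h1 h2; split; first by nra.
have := sqr_ge0 (1 - 2^-1 * (1 + e ^+ 2)); nra.
Qed.

Lemma sqrt_majorant_cauchy e : 0 < e ->
  exists N, forall n, (N <= n)%N -> sqrt_majorant n - sqrt_majorant N < e.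
Proof.
move=> e0; pose S := range sqrt_majorant.
have Sub : has_sup S.
  split; first by exists (sqrt_majorant 0), 0.
  by exists 1 => _ [n _ <-]; have [/andP[]] := sqrt_majorant_bound n.
have [_ [N _ <-] hN] := sup_adherent e0 Sub.
exists N => n _.
have : sqrt_majorant n <= sup S by apply: sup_upper_bound => //; exists n.
lra.
Qed.

(** The limit [l] of the iteration satisfies 2l = c + l^2, so (1 - l)^2 = 1 - c. Whatever commutes
    with [c] commutes with every iterate, hence with [l]. *)
Lemma sqrt_exists c : adj c = c -> nrm c <= 1 ->
  exists b, [/\ adj b = b, nrm (1 - b) <= 1, b * b = 1 - c &
    forall z, GRing.comm z c -> GRing.comm z b].
Proof.
move=> cs c1; pose y := sqrt_iter c; pose e := sqrt_majorant.
have e0 n : 0 <= e n by have [/andP[]] := sqrt_majorant_bound n.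
have ey n : nrm (y n) <= e n.
  elim: n => [|n IH]; first by rewrite /= nrm0.
  rewrite /= nrmZ ger0_norm; last by lra.
  rewrite ler_pM2l; last by lra.
  apply: (le_trans (nrmD _ _)); apply: lerD => //.
  by apply: (le_trans (nrmM _ _)); rewrite expr2 ler_pM ?nrm_ge0.
have step n : nrm (y n.+1 - y n) <= e n.+1 - e n.
  elim: n => [|n IH]; first by rewrite !subr0; exact: ey 1%N.
  (* A difference of squares split without commutativity; the scalar majorant obeys the same
     identity, so the bound propagates. *)
  have -> : y n.+2 - y n.+1 =
      2^-1 *: (y n.+1 * (y n.+1 - y n) + (y n.+1 - y n) * y n).
    rewrite -[y n.+2]/(2^-1 *: (c + y n.+1 * y n.+1)).
    rewrite -{3}[y n.+1]/(2^-1 *: (c + y n * y n)) -scalerBr; congr (_ *: _).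
    by rewrite mulrBr mulrBl addrA subrK opprD addrACA subrr add0r.
  rewrite nrmZ ger0_norm; last by lra.
  have -> : e n.+2 - e n.+1 =
      2^-1 * (e n.+1 * (e n.+1 - e n) + (e n.+1 - e n) * e n).
    by rewrite -[e n.+2]/(2^-1 * (1 + e n.+1 ^+ 2)) -[in X in _ - X]/(2^-1 * (1 + e n ^+ 2)) /=; ring.
  rewrite ler_pM2l; last by lra.
  apply: (le_trans (nrmD _ _)); apply: lerD; apply: (le_trans (nrmM _ _));
    by apply: ler_pM; rewrite ?nrm_ge0.
have steps n k : nrm (y (n + k)%N - y n) <= e (n + k)%N - e n.
  elim: k => [|k IH]; first by rewrite addn0 !subrr nrm0.
  rewrite addnS; apply: (le_trans (nrm_triangle (y (n + k)%N) _ _)).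
  by have := step (n + k)%N; lra.
have [l ll] : exists l, forall d, 0 < d ->
    exists N, forall n, (N <= n)%N -> nrm (y n - l) < d.
  apply: nrm_complete => d d0; have [N hN] := sqrt_majorant_cauchy d0.
  exists N => n Nn; rewrite -(subnKC Nn); apply: (le_lt_trans (steps _ _)).
  by apply: hN; rewrite leq_addr.
have ys n : adj (y n) = y n.
  by elim: n => [|n IH] /=; rewrite ?adj0 // adjZ adjD adjM IH cs.
have ls : adj l = l.
  apply/eqP; rewrite -subr_eq0; apply/eqP; apply: (@nrm_small _ 2) => d d0.
  have [N /(_ N (leqnn N)) hN] := ll _ d0.
  apply: (le_trans (nrm_triangle (y N) _ _)).
  by rewrite -{1}(ys N) -adjB nrm_adj nrmC; lra.
have l1 : nrm l <= 1.
  apply/ler_addgt0Pl => d d0; have [N /(_ N (leqnn N)) hN] := ll _ d0.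
  have := nrmB (y N) (y N - l); rewrite opprB addrC subrK => /le_trans; apply.
  by have [/andP[_ ?] _] := sqrt_majorant_bound N; have := ey N; rewrite /e; lra.
have y1 n : nrm (y n) <= 1.
  by apply: (le_trans (ey n)); have [/andP[_ ?] _] := sqrt_majorant_bound n.
have lE : l = 2^-1 *: (c + l * l).
  apply/eqP; rewrite -subr_eq0; apply/eqP; apply: (@nrm_small _ 2) => d d0.
  have [N hN] := ll _ d0; have := hN N (leqnn N); have := hN N.+1 (leqnSn N).
  move=> h1 h2; apply: (le_trans (nrm_triangle (y N.+1) _ _)).
  rewrite (nrmC l) /= -scalerBr nrmZ ger0_norm; last by lra.
  have -> : c + sqrt_iter c N * sqrt_iter c N - (c + l * l) =
      y N * (y N - l) + (y N - l) * l.
    by rewrite mulrBr mulrBl addrA subrK opprD addrACA subrr add0r.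
  have := nrmD (y N * (y N - l)) ((y N - l) * l).
  have := nrmM (y N) (y N - l); have := nrmM (y N - l) l.
  have := nrm_ge0 (y N - l); have := y1 N.
  by move: l1 h1 h2 => /=; clear; nra.
have lc z : GRing.comm z c -> GRing.comm z l.
  move=> zc; have zy n : GRing.comm z (y n).
    elim: n => [|n IH] /=; first exact: commr0.
    by rewrite /GRing.comm -scalerAr -scalerAl (commrD zc (commrM IH IH)).
  apply/eqP; rewrite -subr_eq0; apply/eqP; apply: (@nrm_small _ (2 * nrm z)) => d d0.
  have [N /(_ N (leqnn N)) hN] := ll _ d0.
  have -> : z * l - l * z = (y N - l) * z - z * (y N - l).
    by rewrite mulrBl mulrBr (zy N) opprB [RHS]addrC addrA subrK.
  apply: (le_trans (nrmB _ _)).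
  have := nrmM (y N - l) z; have := nrmM z (y N - l); have := nrm_ge0 z.
  by move: hN; clear; nra.
exists (1 - l); split.
- by rewrite adjB adj1 ls.
- by rewrite opprB addrC subrK.
- have : 2 *: l = c + l * l by rewrite {1}lE scalerA divff ?scale1r // pnatr_eq0.
  rewrite scaler_nat mulr2n => h.
  have {h} -> : c = l + l - l * l by rewrite h addrK.
  by rewrite mulrBl mul1r mulrBr mulr1 !opprB -addrA; congr (_ + _); rewrite addrCA opprD.
- by move=> z zc; apply: commrB; [exact: commr1|exact: lc].
Qed.

End UnitalCStarTheory.

(** * The positive cone *)

Section PositiveCone.
Context (R : realType) (U : ucstarType R).
Implicit Types x y z a b c : U.

(* For self-adjoint [a] this says that the spectrum of [a] is nonnegative. *)
Definition pos a := adj a = a /\ exists2 t, 0 < t & nrm (t%:A - a) <= t.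

Lemma pos_adj a : pos a -> adj a = a. Proof. by case. Qed.

Lemma pos0 : pos 0.
Proof.
split; first exact: adj0.
by exists 1 => //; rewrite subr0; apply: le_trans (nrmA _ _) _; rewrite normr1.
Qed.

Lemma posZ t a : 0 <= t -> pos a -> pos (t *: a).
Proof.
rewrite le_eqVlt => /predU1P[<- _|t0 [sa [k k0 h]]]; first by rewrite scale0r; exact: pos0.
split; first by rewrite adjZ sa.
exists (t * k); first exact: mulr_gt0.
by rewrite -scalerA -scalerBr nrmZ gtr0_norm // ler_pM2l.
Qed.

Lemma posD a b : pos a -> pos b -> pos (a + b).
Proof.
move=> [sa [k k0 h]] [sb [l l0 g]]; split; first by rewrite adjD sa sb.
exists (k + l); first exact: addr_gt0.
by rewrite scalerDl opprD addrACA; apply: (le_trans (nrmD _ _)); exact: lerD.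
Qed.

Lemma posA t : 0 <= t -> pos (t%:A).
Proof.
move=> t0; apply: posZ => //; split; first exact: adj1.
by exists 1 => //; rewrite scale1r subrr nrm0.
Qed.

Lemma pos1 : pos 1. Proof. by rewrite -[1]scale1r; exact: posA. Qed.

(** The norm bound in [pos] puts c = 1 - a/t in the unit ball, so the root is sqrt(t) times the root
    of 1 - c. *)
Lemma pos_sqrt a : pos a -> exists b,
  [/\ pos b, b * b = a & forall z, GRing.comm z a -> GRing.comm z b].
Proof.
move=> [sa [t t0 h]]; pose c := 1 - t^-1 *: a.
have [] := @sqrt_exists _ _ c.
- by rewrite adjB adj1 adjZ sa.
- have -> : c = t^-1 *: (t%:A - a).
    by rewrite scalerBr scalerA mulVf ?scale1r ?gt_eqF.
  rewrite nrmZ.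
  by rewrite gtr0_norm ?invr_gt0 // mulrC ler_pdivrMr // mul1r.
move=> b [sb b1 bb bC]; exists (Num.sqrt t *: b); split.
- apply: posZ; first exact: sqrtr_ge0.
  by split => //; exists 1 => //; rewrite scale1r.
- rewrite -scalerAl -scalerAr scalerA -expr2 sqr_sqrtr ?ltW // bb /c.
  by rewrite opprB addrC subrK scalerA divff ?scale1r ?gt_eqF.
- move=> z za; rewrite /GRing.comm -scalerAl -scalerAr bC //.
  apply: commrB; first exact: commr1.
  by rewrite /GRing.comm -scalerAl -scalerAr za.
Qed.

Lemma nrm_ii x : nrm (ii * x) = nrm x.
Proof.
apply/eqP; rewrite -(eqrXn2 (n := 2)) ?nrm_ge0 // -!nrm_adjM adjM adj_ii.
by rewrite mulrA -(mulrA (adj x)) mulNr iiii opprK mulr1.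
Qed.

(* [b + ii * c] is normal, and [b] is its real part. *)
Lemma nrm_sum_sqr b c : adj b = b -> adj c = c -> GRing.comm b c ->
  nrm b ^+ 2 <= nrm (b * b + c * c).
Proof.
move=> sb sc bc; pose u := b + ii * c.
have su : adj u = b - ii * c.
  by rewrite adjD adjM sb sc adj_ii mulrN iiC.
have uu : adj u * u = b * b + c * c.
  rewrite su mulrDr !mulrBl -addrA; congr (_ + _).
  have -> : b * (ii * c) = ii * c * b by rewrite -mulrA -bc !mulrA iiC.
  by rewrite addrA addNr add0r mulrA -(mulrA ii) -iiC mulrA iiii mulN1r mulNr opprK.
rewrite -uu nrm_adjM ler_pXn2r ?nnegrE ?nrm_ge0 //.
have h : 2 *: b = u + adj u by rewrite su /u addrACA subrr addr0 scaler_nat mulr2n.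
have := nrmD u (adj u); rewrite -h nrmZ nrm_adj ger0_norm //; clear; lra.
Qed.

Lemma sum_sqr_eq0 b c : adj b = b -> adj c = c -> GRing.comm b c ->
  b * b + c * c = 0 -> b = 0.
Proof.
move=> sb sc bc h; have := nrm_sum_sqr sb sc bc; rewrite h nrm0 => h'.
by apply: nrm0_eq0; apply/eqP; rewrite -sqrf_eq0; apply/eqP/le_anti; rewrite h' sqr_ge0.
Qed.

(** The roots b of a and c of -a commute and b^2 + c^2 = 0, so b = 0. *)
Lemma pos_anti a : pos a -> pos (- a) -> a = 0.
Proof.
move=> /[dup] pa /pos_sqrt[b [/pos_adj sb ba bC]] /pos_sqrt[c [/pos_adj sc ca cC]].
have bc : GRing.comm b c by apply: cC; apply: commrN; apply/commr_sym/bC.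
by rewrite -ba (@sum_sqr_eq0 b c) ?mul0r // ba ca subrr.
Qed.

(** After scaling to norm at most 1, b = sqrt(1 - y^2) commutes with y, so nrm(1 - y^2) <= nrm(b)^2
    <= nrm(b^2 + y^2) = nrm(1) <= 1. *)
Lemma pos_sqr x : adj x = x -> pos (x * x).
Proof.
move=> sx; pose k := nrm x + 1.
have k0 : 0 < k by have := nrm_ge0 x; rewrite /k; clear; lra.
pose y := k^-1 *: x; have sy : adj y = y by rewrite adjZ sx.
have y1 : nrm y <= 1.
  rewrite nrmZ gtr0_norm ?invr_gt0 // mulrC ler_pdivrMr // mul1r /k; clear; lra.
have xE : x = k *: y by rewrite scalerA divff ?scale1r // gt_eqF.
rewrite xE -scalerAl -scalerAr scalerA; apply: posZ; first by rewrite mulr_ge0 // ltW.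
have sc : adj (y * y) = y * y by rewrite adjM sy.
have c1 : nrm (y * y) <= 1.
  by rewrite nrm_sqr // expr_le1 ?nrm_ge0.
have [b [sb _ bb bC]] := sqrt_exists sc c1.
have cby : GRing.comm b y by apply/commr_sym/bC/commrM.
split => //; exists 1 => //; rewrite scale1r -bb.
apply: (le_trans (nrmM _ _)); rewrite -expr2.
by apply: (le_trans (nrm_sum_sqr sb sy cby)); rewrite bb subrK nrm1_le1.
Qed.

Lemma posM a b : GRing.comm a b -> pos a -> pos b -> pos (a * b).
Proof.
move=> ab /[dup] pa /pos_sqrt[s [/pos_adj ss sa sC]] /pos_sqrt[t [/pos_adj st tb tC]].
have tA : GRing.comm t a by apply/commr_sym/tC.
have stC : GRing.comm s t by apply/commr_sym/sC.
have -> : a * b = (s * t) * (s * t).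
  by rewrite -sa -tb -[RHS]mulrA (mulrA t) -stC -!mulrA.
by apply: pos_sqr; rewrite adjM ss st.
Qed.

Lemma abs_exists a : adj a = a -> exists r,
  [/\ pos r, r * r = a * a & forall z, GRing.comm z a -> GRing.comm z r].
Proof.
move=> sa; have [r [pr rr rC]] := pos_sqrt (pos_sqr sa).
by exists r; split => // z za; apply/rC/commrM.
Qed.

Lemma comm_absBM a r : GRing.comm a r -> r * r = a * a -> a * (r - a) = - (r * (r - a)).
Proof. by move=> ar rr; rewrite !mulrBr opprB ar rr. Qed.

(** [m] is twice the negative part of [a]. With s a root of r, the hypothesis gives (sm)^2 = 0,
    hence rm = 0, am = 0 and m^2 = (r - a)m = 0. *)
Lemma abs_eq a r : adj a = a -> pos r -> r * r = a * a -> GRing.comm a r ->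
  r * ((r - a) * (r - a)) = 0 -> a = r.
Proof.
move=> sa /[dup] pr /pos_sqrt[s [/pos_adj ss sr sC]] rr ar h; set m := r - a in h *.
have rs : adj r = r by exact: pos_adj.
have sm : adj m = m by rewrite adjB rs sa.
have s_m : GRing.comm s m.
  rewrite /m; apply: commrB; first exact/commr_sym/sC/commr_refl.
  exact/commr_sym/sC.
have sm0 : s * m = 0.
  apply: sqr_eq0; first by rewrite adjM ss sm s_m.
  by rewrite -mulrA (mulrA m) -s_m -(mulrA s m) mulrA sr.
have rm0 : r * m = 0 by rewrite -sr -mulrA sm0 mulr0.
have am0 : a * m = 0 by rewrite comm_absBM // rm0 oppr0.
have mm : (r - a) * m = 0 by rewrite mulrBl rm0 am0 subr0.
by apply/esym/eqP; rewrite -subr_eq0 -/m; apply/eqP/sqr_eq0.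
Qed.

Lemma mulDD a b : (a + b) * (a + b) = (a * a + b * b) + (a * b + b * a).
Proof. by rewrite mulrDl !mulrDr [b * a + _]addrC addrACA. Qed.

(* Since [(1 + y y')^n y = y (1 + y' y)^n] with [y' = adj y], the powers of [1 + y y']
   grow at most linearly, so the C*-identity forces [nrm (1 + y y') <= 1]. *)
Lemma adjM_neg_eq0_unit y : nrm (1 + adj y * y) <= 1 -> pos (- (adj y * y)) -> y = 0.
Proof.
move=> h pv; set v := adj y * y in h pv; pose w := y * adj y; pose u := 1 + w.
pose K := nrm y ^+ 2.
have uy1 : u * y = y * (1 + v) by rewrite mulrDl mulrDr mul1r mulr1 /v mulrA.
have uy n : u ^+ n * y = y * (1 + v) ^+ n.
  elim: n => [|n IH]; first by rewrite !expr0 mul1r mulr1.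
  by rewrite exprSr -mulrA uy1 mulrA IH -mulrA -exprSr.
have uw n : nrm (u ^+ n * w) <= K.
  rewrite mulrA uy -mulrA; apply: (le_trans (nrmM _ _)); rewrite /K expr2.
  apply: ler_pM; rewrite ?nrm_ge0 //.
  apply: (le_trans (nrmM _ _)); rewrite nrm_adj ler_piMl ?nrm_ge0 //.
  elim: n => [|n IH]; first by rewrite expr0 nrm1_le1.
  rewrite exprS; apply: (le_trans (nrmM _ _)).
  by rewrite -[leRHS]mulr1 ler_pM ?nrm_ge0.
have un n : nrm (u ^+ n) <= 1 + n%:R * K.
  elim: n => [|n IH]; first by rewrite expr0 mul0r addr0 nrm1_le1.
  rewrite exprSr mulrDr mulr1; apply: (le_trans (nrmD _ _)).
  by have := uw n; rewrite -natr1; move: IH; clear; lra.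
have sw : adj w = w by rewrite adjM adjK.
have sun n : adj (u ^+ n) = u ^+ n.
  elim: n => [|n IH]; first by rewrite expr0 adj1.
  by rewrite {1}exprS exprSr adjM IH adjD adj1 sw.
have u2 k : nrm u ^+ (2 ^ k) = nrm (u ^+ (2 ^ k)).
  elim: k => [|k IH]; first by rewrite expn0 !expr1.
  by rewrite expnSr !exprM IH [in RHS]expr2 nrm_sqr.
have K0 : 0 <= K by exact: sqr_ge0.
have u1 : nrm u <= 1.
  rewrite leNgt; apply/negP => u1; pose q := nrm u - 1.
  have q0 : 0 < q by rewrite subr_gt0.
  have bern n : 1 + n%:R * q <= nrm u ^+ n.
    elim: n => [|n IH]; first by rewrite expr0 mul0r addr0.
    rewrite exprS -natr1; have N0 : 0 <= n%:R :> R by exact: ler0n.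
    have uq : nrm u = 1 + q by rewrite addrC subrK.
    rewrite {1}uq.
    have := mulr_ge0 (ltW q0) (mulr_ge0 N0 (ltW q0)).
    rewrite -subr_ge0 in IH; have := mulr_ge0 (ltW q0) IH; move: IH.
    by move: (_ ^+ n) => E; clear; lra.
  (* For n = 2^k >= k > B the square of Bernoulli's lower bound at exponent n, at least (nq)^2,
     exceeds the linear upper bound 1 + 2nK at exponent 2n. *)
  pose B := (1 + 2 * K) / q ^+ 2.
  have [k hk] : exists k : nat, B < k%:R.
    exists (Num.bound B); apply: le_lt_trans (archi_boundP _) => //.
    by rewrite divr_ge0 ?sqr_ge0 //; move: K0; clear; lra.
  have kN : k%:R <= (2 ^ k)%:R :> R by rewrite ler_nat ltnW // ltn_expl.
  set N := (2 ^ k)%N in kN; have N1 : 1 <= N%:R :> R by rewrite ler1n expn_gt0.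
  have := un (2 ^ k.+1)%N; rewrite -u2 expnSr exprM -/N natrM.
  have := bern N; move: hk; rewrite /B ltr_pdivrMr ?exprn_gt0 //.
  move: kN N1 K0 q0; move: (N%:R) (k%:R) (nrm u ^+ N) => n j E; clear.
  move=> kn n1 K0 q0 h1 h2 h3.
  have nq0 : 0 <= n * q by apply: mulr_ge0; [lra|exact: ltW].
  have hE : (n * q) ^+ 2 <= E ^+ 2 by rewrite ler_pXn2r ?nnegrE //; lra.
  have hn : n * (1 + 2 * K) < n * (n * q ^+ 2).
    by rewrite ltr_pM2l; [apply: (lt_le_trans h1); rewrite ler_wpM2r ?sqr_ge0|lra].
  move: hE hn h3; rewrite !expr2; move: n1; clear; lra.
have pw : pos (- w).
  by split; [rewrite adjN sw|exists 1 => //; rewrite scale1r opprK].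
(* Up to factors these are the real and imaginary parts of y, and their squares sum to 2(v + w). As
   -w is positive, so is v; but -v is positive too, so v = 0. *)
pose y1 := y + adj y; pose y2 := ii * (y - adj y).
have p1 : pos (y1 * y1) by apply: pos_sqr; rewrite adjD adjK addrC.
have p2 : pos (y2 * y2).
  by apply: pos_sqr; rewrite adjM adjB adjK adj_ii mulrN -mulNr opprB -iiC.
have e : y1 * y1 + y2 * y2 = 2 *: (v + w).
  rewrite /y2 mulrA -(mulrA ii) -iiC mulrA iiii mulN1r mulNr.
  rewrite /y1 !mulDD !(mulNr, mulrN) opprK opprD addrACA subrr add0r -opprD opprK.
  by rewrite scaler_nat mulr2n (addrC v).
have : pos (2 *: v).
  have -> : 2 *: v = y1 * y1 + y2 * y2 + 2 *: (- w) by rewrite e -scalerDr addrK.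
  by apply: posD; [exact: posD|exact: posZ].
move=> /(posZ (t := 2^-1)); rewrite scalerA mulVf ?pnatr_eq0 // scale1r => pv2.
by apply: adjM_eq0; apply: pos_anti => //; apply: pv2; rewrite invr_ge0.
Qed.

End PositiveCone.

(** * Positivity of [adj x * x], Jordan decomposition and norm estimates *)

Section PositiveSquares.
Context (R : realType) (U : ucstarType R).
Implicit Types x y z a b c p n : U.

Lemma adjM_neg_eq0 y : pos (- (adj y * y)) -> y = 0.
Proof.
move=> /[dup] pv [_ [t t0]]; rewrite opprK => h.
pose k := (Num.sqrt t)^-1; have k0 : 0 < k by rewrite invr_gt0 sqrtr_gt0.
have kk : k * k = t^-1 by rewrite -expr2 exprVn sqr_sqrtr // ltW.
have ky : adj (k *: y) * (k *: y) = t^-1 *: (adj y * y).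
  by rewrite adjZ -scalerAl -scalerAr scalerA kk.
have /eqP : k *: y = 0.
  apply: adjM_neg_eq0_unit; rewrite ky.
    have -> : 1 + t^-1 *: (adj y * y) = t^-1 *: (t%:A + adj y * y).
      by rewrite scalerDr scalerA mulVf ?scale1r ?gt_eqF.
    by rewrite nrmZ gtr0_norm ?invr_gt0 // mulrC ler_pdivrMr // mul1r.
  by rewrite -scalerN; apply: posZ; rewrite ?invr_ge0 ?ltW.
by rewrite scaler_eq0 gt_eqF //= => /eqP.
Qed.

(** With r = |a| and m = r - a, the square of xm in the sense of [adjM_neg_eq0] is mam = -r m^2,
    which is negative; so xm = 0 and a = r. *)
Lemma pos_adjM x : pos (adj x * x).
Proof.
set a := adj x * x; have sa : adj a = a by rewrite adjM adjK.
have [r [pr rr rC]] := abs_exists sa.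
have ar : GRing.comm a r by exact/rC/commr_refl.
pose m := r - a; have sm : adj m = m by rewrite adjB sa pos_adj.
have rm : GRing.comm r m.
  by apply: commrB; [exact: commr_refl|exact/commr_sym].
have xm : adj (x * m) * (x * m) = - (r * (m * m)).
  rewrite adjM sm -mulrA (mulrA (adj x)) -/a comm_absBM //.
  by rewrite mulrN (mulrA m r) -rm -mulrA.
have x0 : x * m = 0.
  apply: adjM_neg_eq0; rewrite xm opprK.
  by apply: posM => //; [exact: commrM|exact: pos_sqr].
suff -> : a = r by [].
apply: abs_eq => //; apply/eqP; rewrite -oppr_eq0 -xm x0 mulr0; exact: eqxx.
Qed.

Lemma pos_conj x a : pos a -> pos (adj x * a * x).
Proof.
move=> /pos_sqrt[b [/pos_adj sb <- _]].
by rewrite mulrA -mulrA -{1}sb -adjM; exact: pos_adjM.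
Qed.

Lemma pos_conj_sa x a : adj x = x -> pos a -> pos (x * a * x).
Proof. by move=> sx /(pos_conj x); rewrite sx. Qed.

(** In spectral terms p(r - p) = 0 makes p equal to 0 or to r >= 0 at each point. Algebraically,
    with q = |p| and m = q - p, the square (pm)^2 = -rqm^2 is both positive and negative. *)
Lemma pos_comm_sqr p r : adj p = p -> pos r -> GRing.comm p r -> p * r = p * p -> pos p.
Proof.
move=> sp pr cpr prE; have [q [pq qq qC]] := abs_exists sp.
have pqC : GRing.comm p q by exact/qC/commr_refl.
have rqC : GRing.comm r q by exact/qC/commr_sym.
pose m := q - p; have sm : adj m = m by rewrite adjB sp pos_adj.
have pm : p * m = - (q * m) by exact: comm_absBM.
have pmC : GRing.comm p m by apply: commrB => //; exact: commr_refl.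
have rmC : GRing.comm r m by apply: commrB => //; exact: commr_sym.
have qmC : GRing.comm q m by apply: commrB; [exact: commr_refl|exact: commr_sym].
have spm : adj (p * m) = p * m by rewrite adjM sp sm pmC.
have e : r * q * (m * m) = - (p * m * (p * m)).
  have -> : r * q * (m * m) = - (r * p * (m * m)).
    by rewrite mulrA -(mulrA r q) -[q * m]opprK -pm mulrN mulNr !mulrA.
  congr (- _); rewrite -cpr prE -[RHS]mulrA (mulrA m p) -pmC.
  by rewrite !mulrA.
have pm0 : p * m = 0.
  apply: sqr_eq0 => //; apply: pos_anti; first exact: pos_sqr.
  rewrite -e; apply: posM; first by apply: commrM; apply/commr_sym/commrM; apply/commr_sym.
    exact: posM.
  exact: pos_sqr.
have qm0 : q * m = 0 by apply/eqP; rewrite -oppr_eq0 -pm pm0.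
suff -> : p = q by [].
by apply: abs_eq => //; rewrite -/m mulrA qm0 mul0r.
Qed.

(** [pos_comm_sqr] applies through (r + a)(2r) = (r + a)^2, a consequence of r^2 = a^2. *)
Lemma pos_absD a r : adj a = a -> pos r -> GRing.comm a r -> r * r = a * a -> pos (r + a).
Proof.
move=> sa pr ar rr; apply: (@pos_comm_sqr _ (r + r)).
- by rewrite adjD sa pos_adj.
- exact: posD.
- by apply: commrD; apply/commr_sym/commrD; rewrite //; exact: commr_refl.
- rewrite !mulrDr !mulrDl rr ar; congr (_ + _); exact: addrC.
Qed.

Lemma jordan a : adj a = a -> exists p n,
  [/\ pos p, pos n, a = p - n, p * n = 0 & n * p = 0].
Proof.
move=> sa; have [r [pr rr rC]] := abs_exists sa.
have ar : GRing.comm a r by exact/rC/commr_refl.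
have half (x : U) : 2^-1 *: (x + x) = x.
  by rewrite -mulr2n -[x *+ 2]scaler_nat scalerA mulVf ?pnatr_eq0 // scale1r.
exists (2^-1 *: (r + a)), (2^-1 *: (r - a)); split.
- by apply: posZ; [rewrite invr_ge0|exact: pos_absD].
- apply: posZ; first by rewrite invr_ge0.
  apply: pos_absD => //; first by rewrite adjN sa.
    by rewrite /GRing.comm mulNr mulrN ar.
  by rewrite mulNr mulrN opprK.
- by rewrite -scalerBr opprD addrACA subrr add0r opprK half.
- rewrite -scalerAl -scalerAr mulrDl !mulrDr !mulrN rr ar.
  by rewrite addrA subrK subrr !scaler0.
- rewrite -scalerAl -scalerAr mulrDl !mulrDr !mulNr rr ar.
  by rewrite -opprD [r * a + _]addrC subrr !scaler0.
Qed.

Lemma pos_ubound x t : adj x = x -> nrm x <= t -> pos (t%:A - x).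
Proof.
move=> sx xt; split; first by rewrite adjB adjA sx.
exists (t + 1); first by have := nrm_ge0 x; move: xt; clear; lra.
have -> : (t + 1)%:A - (t%:A - x) = 1 + x.
  by rewrite scalerDl scale1r opprB addrC addrA subrK addrC.
apply: (le_trans (nrmD _ _)); have := nrm1_le1 U; move: xt; clear; lra.
Qed.

Lemma pos_nrm a : adj a = a -> pos ((nrm a)%:A - a).
Proof. by move=> sa; exact: pos_ubound. Qed.

(** Write a = b^2 and t - a = c^2 with commuting roots; then nrm(b)^2 <= nrm(b^2 + c^2), the norm of
    the scalar t. *)
Lemma nrm_le_pos a t : 0 <= t -> pos a -> pos (t%:A - a) -> nrm a <= t.
Proof.
move=> t0 /pos_sqrt[b [/pos_adj sb ba bC]] /pos_sqrt[c [/pos_adj sc ca cC]].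
have bc : GRing.comm b c.
  apply: cC; apply: commrB; last by rewrite -ba; apply: commrM; exact: commr_refl.
  by rewrite /GRing.comm -scalerAl -scalerAr mulr1 mul1r.
have := nrm_sum_sqr sb sc bc; rewrite ba ca addrC subrK => h.
rewrite -ba; apply: (le_trans (nrmM _ _)); rewrite -expr2; apply: (le_trans h).
by apply: (le_trans (nrmA _ _)); rewrite ger0_norm.
Qed.

Lemma nrm_mono a b : pos a -> pos (b - a) -> nrm a <= nrm b.
Proof.
move=> pa pba; apply: nrm_le_pos; rewrite ?nrm_ge0 //.
have sb : adj b = b by rewrite -(subrK a b) adjD !pos_adj.
by have := posD (pos_nrm sb) pba; rewrite addrA subrK.
Qed.

(** Compressing p - n <= t by p removes n and gives p^3 <= t p^2; then nrm(p)^4 = nrm(p^4) <= nrm(p)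
    nrm(p^3) <= t nrm(p)^3. *)
Lemma nrm_pospart p n t : pos p -> pos n -> p * n = 0 -> n * p = 0 -> 0 <= t ->
  pos (t%:A - (p - n)) -> nrm p <= t.
Proof.
move=> pp pn pn0 np0 t0 h; have sp := pos_adj pp.
have pppP : pos (p * p * p) by exact: pos_conj_sa.
have : pos (t *: (p * p) - p * p * p).
  have := pos_conj_sa sp h; rewrite mulrBr mulrBl -scalerAr mulr1 -scalerAl.
  by rewrite mulrBr pn0 subr0.
move=> /(nrm_mono pppP); rewrite nrmZ nrm_sqr // ger0_norm // => h1.
have h2 : nrm p ^+ 2 ^+ 2 <= nrm p * nrm (p * p * p).
  rewrite -nrm_sqr // -nrm_sqr; last by rewrite adjM sp.
  by rewrite -!mulrA (mulrA p p p); exact: nrmM.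
have [->//|p0] := eqVneq (nrm p) 0.
have {}p0 : 0 < nrm p by rewrite lt_def p0 nrm_ge0.
have p3 : 0 < nrm p ^+ 3 by exact: exprn_gt0.
rewrite -(ler_pM2l p3) -exprSr (exprM (nrm p) 2 2); apply: (le_trans h2).
by rewrite [nrm p ^+ 3]exprS -[leRHS]mulrA ler_pM2l // [leRHS]mulrC.
Qed.

End PositiveSquares.

(** * Extreme functionals below a sublinear functional *)

Section ScalarFunctionals.
Context (K : comNzRingType) (V : lmodType K) (f : V -> K) (fl : scalar f).

Lemma scalarfD x y : f (x + y) = f x + f y.
Proof. by rewrite -[x]scale1r fl mul1r scale1r. Qed.

Lemma scalarf0 : f 0 = 0.
Proof. by apply: (addrI (f 0)); rewrite -scalarfD !addr0. Qed.

Lemma scalarfZ t x : f (t *: x) = t * f x.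
Proof. by rewrite -[_ *: _]addr0 fl scalarf0 addr0. Qed.

Lemma scalarfN x : f (- x) = - f x.
Proof. by rewrite -scaleN1r scalarfZ mulN1r. Qed.

Lemma scalarfB x y : f (x - y) = f x - f y.
Proof. by rewrite scalarfD scalarfN. Qed.

End ScalarFunctionals.

Section ExtremeFunctionals.
Context (R : realType) (V : lmodType R).
Implicit Types (p q f g h : V -> R) (x y : V).

Definition sublinear p :=
  (forall x y, p (x + y) <= p x + p y) /\ (forall t x, 0 < t -> p (t *: x) = t * p x).

Lemma sublinear0 p : sublinear p -> p 0 = 0.
Proof. by case=> _ pZ; have := pZ 2 0 (ltr0Sn _ _); rewrite scaler0; lra. Qed.

Lemma sublinearZ p t x : sublinear p -> 0 <= t -> p (t *: x) = t * p x.
Proof.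
move=> ps; rewrite le_eqVlt => /predU1P[<-|]; last exact: ps.2.
by rewrite scale0r mul0r sublinear0.
Qed.

Lemma sublinearN p x : sublinear p -> - p (- x) <= p x.
Proof. by move=> ps; have := ps.1 x (- x); rewrite subrr sublinear0 //; lra. Qed.

(* The functionals below [face q y] are those below [q] which attain [q y] at
   [y]. *)
Definition face_values q y x := [set q (x + t *: y) - t * q y | t in [set t | 0 <= t]].
Definition face q y x := inf (face_values q y x).

Section Face.
Context (q : V -> R) (qs : sublinear q) (y : V).

Lemma face_has_inf x : has_inf (face_values q y x).
Proof.
split; first by exists (q (x + 0 *: y) - 0 * q y), 0 => /=.
exists (- q (- x)) => _ [t /= t0 <-].
have := qs.1 (x + t *: y) (- x); rewrite addrAC subrr add0r sublinearZ //; lra.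
Qed.

Lemma face_le x t : 0 <= t -> face q y x <= q (x + t *: y) - t * q y.
Proof. by move=> t0; apply: ge_inf; [case: (face_has_inf x)|exists t]. Qed.

Lemma face_ge x a : (forall t, 0 <= t -> a <= q (x + t *: y) - t * q y) -> a <= face q y x.
Proof.
move=> h; apply: lb_le_inf; first by case: (face_has_inf x).
by move=> _ [t t0 <-]; exact: h.
Qed.

Lemma face_le_self x : face q y x <= q x.
Proof. by have := @face_le x 0 (lexx _); rewrite scale0r addr0 mul0r subr0. Qed.

Lemma face_attained : face q y (- y) <= - q y.
Proof.
have := @face_le (- y) 1 ler01.
by rewrite scale1r addNr sublinear0 // mul1r sub0r.
Qed.

Lemma face_sublinear : sublinear (face q y).
Proof.
have faceZ_le t x : 0 < t -> face q y (t *: x) <= t * face q y x.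
  move=> t0; rewrite mulrC -ler_pdivrMr //; apply: face_ge => s s0.
  rewrite ler_pdivrMr //.
  have := @face_le (t *: x) (t * s) (mulr_ge0 (ltW t0) s0).
  by rewrite -scalerA -scalerDr qs.2 // => /le_trans; apply; rewrite -mulrA -mulrBr mulrC.
split=> [x x'|t x t0]; last first.
  apply/le_anti; rewrite faceZ_le //= mulrC -ler_pdivlMr //.
  have ti0 : 0 < t^-1 by rewrite invr_gt0.
  have := faceZ_le t^-1 (t *: x) ti0.
  by rewrite scalerA mulVf ?gt_eqF // scale1r mulrC.
rewrite -lerBlDr; apply: face_ge => s s0; rewrite lerBlDr [leRHS]addrC -lerBlDr.
apply: face_ge => t t0; rewrite lerBlDr.
apply: (le_trans (@face_le (x + x') (t + s) (addr_ge0 t0 s0))).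
have := qs.1 (x + s *: y) (x' + t *: y).
by rewrite addrACA -scalerDl (addrC s); lra.
Qed.

End Face.

(** Zorn's lemma yields a minimal sublinear face of [p] below [face p y0]. Minimality makes it equal
    to its own face at every y, hence odd, hence linear; being a face makes it extreme. *)
Theorem extreme_functional p y0 : sublinear p -> exists f,
  [/\ scalar f, forall x, f x <= p x, f y0 = p y0 &
    forall g h t, scalar g -> scalar h -> 0 < t < 1 ->
      (forall x, g x <= p x) -> (forall x, h x <= p x) ->
      (forall x, f x = t * g x + (1 - t) * h x) -> g = f /\ h = f].
Proof.
move=> ps.
(* A sublinear [q] stands for the convex set of linear functionals below it; the last clause makes
   this set a face of the one belonging to [p]. *)
pose isface q := [/\ sublinear q, forall x, q x <= p x &
  forall g h t, scalar g -> scalar h -> 0 < t < 1 ->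
    (forall x, g x <= p x) -> (forall x, h x <= p x) ->
    (forall x, t * g x + (1 - t) * h x <= q x) ->
    (forall x, g x <= q x) /\ (forall x, h x <= q x)].
have face_isface q y : isface q -> isface (face q y).
  move=> [qs qp qf]; split; first exact: face_sublinear.
    by move=> x; apply: le_trans (face_le_self _ _ _) (qp x).
  move=> g h t gs hs t01 gp hp gh.
  have [gq hq] := qf g h t gs hs t01 gp hp
    (fun x => le_trans (gh x) (face_le_self qs y x)).
  have := le_trans (gh (- y)) (face_attained qs y); rewrite (scalarfN gs) (scalarfN hs) => ghy.
  have [gy hy] : g y = q y /\ h y = q y.
    have g1 := gq y; have h1 := hq y; have /andP[t0 t1] := t01.
    have e1 : 0 <= t * (q y - g y) by rewrite mulr_ge0 ?subr_ge0 // ltW.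
    have e2 : 0 <= (1 - t) * (q y - h y) by rewrite mulr_ge0 ?subr_ge0 // ltW.
    have e3 : t * (q y - g y) = 0 by lra.
    have e4 : (1 - t) * (q y - h y) = 0 by lra.
    move/eqP: e3; rewrite mulf_eq0 gt_eqF //= subr_eq0 => /eqP <-.
    by move/eqP: e4; rewrite mulf_eq0 gt_eqF ?subr_gt0 //= subr_eq0 => /eqP <-.
  split=> x; apply: face_ge => // s s0.
    by have := gq (x + s *: y); rewrite (scalarfD gs) (scalarfZ gs) gy; lra.
  by have := hq (x + s *: y); rewrite (scalarfD hs) (scalarfZ hs) hy; lra.
have pface : isface p by split.
pose p0 := face p y0; have p0face : isface p0 by exact: face_isface.
pose T := {q | isface q /\ forall x, q x <= p0 x}.
(* The order is reversed: a maximal element is a minimal functional. *)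
pose r (a b : T) := `[< forall x, sval b x <= sval a x >].
have [m mmax] : exists m : T, forall s, r m s -> s = m.
  apply: Zorn => [a|a b c /asboolP ab /asboolP bc|a b /asboolP ab /asboolP ba|A Atot].
  - exact/asboolP.
  - by apply/asboolP => x; exact: le_trans (bc x) (ab x).
  - case: a b ab ba => a pa [b pb] /= ab ba; apply: eq_exist; apply/funext => x; apply/le_anti.
    by rewrite ab ba.
  have [[a0 Aa0]|A0] := pselect (exists a, A a); last first.
    exists (exist _ p0 (conj p0face (fun x => lexx _))) => s As.
    by exfalso; apply: A0; exists s.
  pose S x := [set sval a x | a in A].
  have Sinf x : has_inf (S x).
    split; first by exists (sval a0 x), a0.
    exists (- p (- x)) => _ [a Aa <-]; case: (svalP a) => -[asub ap _] _.
    by have := sublinearN x asub; have := ap (- x); lra.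
  (* The pointwise infimum bounds the chain. It is subadditive because of two members of the chain
     the smaller one can be used at both arguments. *)
  pose q x := inf (S x).
  have q_le a x : A a -> q x <= sval a x.
    by move=> Aa; apply: ge_inf; [case: (Sinf x)|exists a].
  have q_ge x k : (forall a, A a -> k <= sval a x) -> k <= q x.
    move=> h; apply: lb_le_inf; first by case: (Sinf x).
    by move=> _ [a Aa <-]; exact: h.
  have qs : sublinear q.
    have qZ_le t x : 0 < t -> q (t *: x) <= t * q x.
      move=> t0; rewrite mulrC -ler_pdivrMr //; apply/q_ge => a Aa.
      rewrite ler_pdivrMr //; apply: (le_trans (q_le _ _ Aa)).
      by case: (svalP a) => -[asub _ _] _; rewrite asub.2 // mulrC.
    split=> [x y|t x t0]; last first.
      apply/le_anti; rewrite qZ_le //= mulrC -ler_pdivlMr //.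
      have ti0 : 0 < t^-1 by rewrite invr_gt0.
      have := qZ_le t^-1 (t *: x) ti0.
      by rewrite scalerA mulVf ?gt_eqF // scale1r mulrC.
    rewrite -lerBlDr; apply/q_ge => a Aa; rewrite lerBlDr [leRHS]addrC -lerBlDr.
    apply/q_ge => b Ab; rewrite lerBlDr.
    have sub (c : T) u v : sval c (u + v) <= sval c u + sval c v.
      by case: (svalP c) => -[cs _ _] _; exact: cs.1.
    have [/asboolP h|/asboolP h] := Atot a b Aa Ab.
      apply: (le_trans (q_le b _ Ab)); apply: (le_trans (sub _ _ _)).
      by rewrite addrC lerD2l h.
    apply: (le_trans (q_le a _ Aa)); apply: (le_trans (sub _ _ _)).
    by rewrite addrC lerD2r h.
  have qface : isface q.
    split=> // [x|g h t gs hs t01 gp hp gh].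
      apply: (le_trans (q_le _ _ Aa0)).
      by case: (svalP a0) => -[_ ap _] _; exact: ap.
    by split=> x; apply/q_ge => a Aa;
      case: (svalP a) => -[_ _ /(_ g h t gs hs t01 gp hp)[]] //;
      move=> z; apply: le_trans (gh z) (q_le _ _ Aa).
  have qp0 x : q x <= p0 x.
    by apply: (le_trans (q_le _ _ Aa0)); case: (svalP a0) => _; exact.
  exists (exist _ q (conj qface qp0)) => s As; apply/asboolP => x /=.
  exact: q_le.
case: m mmax => f [fface fp0] mmax; have [fs fp ff] := fface.
have fN y : f (- y) = - f y.
  have fp' x : face f y x <= p0 x by apply: le_trans (face_le_self fs y x) (fp0 x).
  have E' : face f y = f.
    pose s : T := exist _ (face f y) (conj (face_isface _ y fface) fp').
    have /mmax/(congr1 sval) : r (exist _ f (conj fface fp0)) s.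
      by apply/asboolP => x /=; exact: face_le_self.
    by [].
  have := face_attained fs y; rewrite E'; have := sublinearN y fs; lra.
have fD x y : f (x + y) = f x + f y.
  have := fs.1 x y; have := fs.1 (x + y) (- y); rewrite addrK fN; lra.
have fl : scalar f.
  move=> t x y; rewrite fD; congr (_ + _).
  have [t0|t0] := leP 0 t; first exact: sublinearZ.
  by rewrite -[t]opprK scaleNr fN sublinearZ ?mulNr // oppr_ge0 ltW.
exists f; split => //.
  apply/le_anti; rewrite fp /=.
  have := le_trans (fp0 (- y0)) (face_attained ps y0); rewrite fN; lra.
move=> g h t gl hl t01 gp hp fE.
have [gf hf] := ff g h t gl hl t01 gp hp (fun x => eq_ind _ (fun k => k <= f x) (lexx _) _ (fE x)).
(* Linear functionals with g <= f agree: compare them at x and at -x. *)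
by split; apply/funext => x; apply/le_anti;
  [have := gf (- x); rewrite (gf x) (scalarfN gl)|have := hf (- x); rewrite (hf x) (scalarfN hl)];
  rewrite (scalarfN fl) /= lerN2.
Qed.

End ExtremeFunctionals.

(** * Positive functionals *)

Section PositiveFunctionals.
Context (R : realType) (U : ucstarType R).
Implicit Types (x y z b : U) (F G H : U -> R).

Definition re x : U := 2^-1 *: (x + adj x).

Lemma re_adj x : adj (re x) = re x.
Proof. by rewrite adjZ adjD adjK addrC. Qed.

Lemma re_sa x : adj x = x -> re x = x.
Proof.
by move=> sx; rewrite /re sx -mulr2n -[x *+ 2]scaler_nat scalerA mulVf ?pnatr_eq0 // scale1r.
Qed.

Lemma reD x y : re (x + y) = re x + re y.
Proof. by rewrite /re adjD addrACA scalerDr. Qed.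

Lemma reZ t x : re (t *: x) = t *: re x.
Proof. by rewrite /re adjZ -scalerDr !scalerA mulrC. Qed.

Lemma reN x : re (- x) = - re x.
Proof. by rewrite -scaleN1r reZ scaleN1r. Qed.

Lemma nrm_re x : nrm (re x) <= nrm x.
Proof.
rewrite nrmZ ger0_norm ?invr_ge0 //; have := nrmD x (adj x); rewrite nrm_adj; lra.
Qed.

(** These are the real parts of positive complex functionals; invariance under [adj] encodes that
    the latter are hermitian. *)
Definition positive_functional F :=
  [/\ scalar F, forall x, pos x -> 0 <= F x & forall x, F (adj x) = F x].

Section Properties.
Context (F : U -> R) (pF : positive_functional F).
Let Fl : scalar F := let: And3 h _ _ := pF in h.
Let Fpos x : pos x -> 0 <= F x := let: And3 _ h _ := pF in h x.
Let Fadj x : F (adj x) = F x := let: And3 _ _ h := pF in h x.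

Lemma pf_mono x y : pos (y - x) -> F x <= F y.
Proof. by move=> /Fpos; rewrite (scalarfB Fl) subr_ge0. Qed.

Lemma pf_re x : F (re x) = F x.
Proof. by rewrite (scalarfZ Fl) (scalarfD Fl) Fadj; lra. Qed.

Lemma pf_scalar t : F t%:A = t * F 1.
Proof. exact: scalarfZ. Qed.

Lemma pf1_ge0 : 0 <= F 1. Proof. exact/Fpos/pos1. Qed.

Lemma pf_le x : F x <= nrm x * F 1.
Proof.
rewrite -pf_re -pf_scalar; apply: pf_mono.
by apply: pos_ubound; [exact: re_adj|exact: nrm_re].
Qed.

Lemma pf_cauchy_schwarz x y : F (adj y * x) ^+ 2 <= F (adj x * x) * F (adj y * y).
Proof.
have h t : 0 <= F (adj x * x) + 2 * t * F (adj y * x) + t ^+ 2 * F (adj y * y).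
  have -> : F (adj x * x) + 2 * t * F (adj y * x) + t ^+ 2 * F (adj y * y) =
      F (adj x * x) + t * F (adj x * y) + (t * F (adj y * x) + t * (t * F (adj y * y))).
    by have -> : F (adj x * y) = F (adj y * x); [rewrite -Fadj adjM adjK|ring].
  rewrite -!(scalarfZ Fl) -!(scalarfD Fl).
  rewrite (scalerAr t (adj x)) (scalerAl t _ x) (scalerAr t (adj y)) (scalerAl t).
  rewrite -!mulrDr -mulrDl -adjZ -adjD.
  exact/Fpos/pos_adjM.
have := Fpos (pos_adjM y); rewrite le_eqVlt => /predU1P[c0|c0].
  rewrite -c0 mulr0; have [->|b0] := eqVneq (F (adj y * x)) 0; first by rewrite expr0n.
  (* This choice of t makes the affine expression equal to -1. *)
  exfalso; have := h (- (F (adj x * x) + 1) / (2 * F (adj y * x))); rewrite -c0.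
  have -> : 2 * (- (F (adj x * x) + 1) / (2 * F (adj y * x))) * F (adj y * x) =
     - (F (adj x * x) + 1) by field.
  by rewrite mulr0; lra.
have := h (- F (adj y * x) / F (adj y * y)).
have -> : F (adj x * x) + 2 * (- F (adj y * x) / F (adj y * y)) * F (adj y * x) +
   (- F (adj y * x) / F (adj y * y)) ^+ 2 * F (adj y * y) =
  (F (adj x * x) * F (adj y * y) - F (adj y * x) ^+ 2) / F (adj y * y).
  by field; rewrite gt_eqF.
by rewrite pmulr_lge0 ?invr_gt0 // subr_ge0.
Qed.

(** Cauchy-Schwarz combined with (1 - b)^2 <= 1 - b, which holds since b(1 - b) is positive. *)
Lemma pf_compl b x : pos b -> pos (1 - b) ->
  F ((1 - b) * x) ^+ 2 <= F (adj x * x) * F (1 - b).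
Proof.
move=> pb pb1; have s1 := pos_adj pb1.
apply: (le_trans (_ : _ <= F (adj x * x) * F ((1 - b) * (1 - b)))).
  by have := pf_cauchy_schwarz x (1 - b); rewrite s1.
apply: ler_wpM2l; first exact/Fpos/pos_adjM.
apply: pf_mono; rewrite -{1}[1 - b]mulr1 -mulrBr subKr.
apply: posM => //; apply/commr_sym/commrB; [exact: commr1|exact: commr_refl].
Qed.

End Properties.

(** * Extreme positive functionals under a cone of linear constraints *)

Section Extension.
Context (K : set (U * R)).
Hypothesis K0 : K (0, 0).
Hypothesis KD : forall y c z d, K (y, c) -> K (z, d) -> K (y + z, c + d).
Hypothesis KZ : forall t y c, 0 < t -> K (y, c) -> K (t *: y, t * c).
Hypothesis K1 : exists c, K (1, c).
Hypothesis K_ge0 : forall y c, K (y, c) -> pos y -> 0 <= c.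

(** A pair (y, c) in [K] is the constraint F y <= c for self-adjoint y; [K_ge0] makes the
    constraints consistent with positivity. *)
Definition dominated F :=
  positive_functional F /\ forall y c, K (y, c) -> adj y = y -> F y <= c.

(** [p] is the best upper bound for F x that the constraints and monotonicity imply; the linear
    functionals below it are exactly the [dominated] ones. *)
Let S x := [set c | exists2 y, K (y, c) & pos (y - re x)].
Let p x := inf (S x).

Let S_inf x : has_inf (S x).
Proof.
have [c0 Kc0] := K1; pose M := nrm x + 1.
have M0 : 0 < M by rewrite ltr_wpDl ?nrm_ge0.
have xM : nrm (re x) <= M by apply: (le_trans (nrm_re x)); rewrite lerDl.
split; first by exists (M * c0), M%:A; [exact: KZ|exact: pos_ubound (re_adj x) xM].
exists (- (M * c0)) => c [y Kyc yx].
suff : 0 <= c + M * c0 by lra.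
apply: (@K_ge0 (y + M%:A)); first by apply: KD => //; exact: KZ.
have := posD yx (@pos_ubound _ _ (- re x) M _ _); rewrite adjN re_adj nrmN.
by rewrite opprK (addrC M%:A) addrA subrK; apply.
Qed.

Let p_le x y c : K (y, c) -> pos (y - re x) -> p x <= c.
Proof. by move=> Kyc yx; apply: ge_inf; [case: (S_inf x)|exists y]. Qed.

Let p_ge x k : (forall y c, K (y, c) -> pos (y - re x) -> k <= c) -> k <= p x.
Proof.
move=> h; apply: lb_le_inf; first by case: (S_inf x).
by move=> c [y Kyc yx]; exact: h yx.
Qed.

Let p_sublinear : sublinear p.
Proof.
have pZ_le t x : 0 < t -> p (t *: x) <= t * p x.
  move=> t0; rewrite mulrC -ler_pdivrMr //; apply: p_ge => y c Kyc yx.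
  rewrite ler_pdivrMr // mulrC; apply: p_le (KZ t0 Kyc) _.
  by rewrite reZ -scalerBr; apply: posZ => //; exact: ltW.
split=> [x x'|t x t0]; last first.
  apply/le_anti; rewrite pZ_le //= mulrC -ler_pdivlMr //.
  have ti0 : 0 < t^-1 by rewrite invr_gt0.
  have := pZ_le t^-1 (t *: x) ti0.
  by rewrite scalerA mulVf ?gt_eqF // scale1r mulrC.
rewrite -lerBlDr; apply: p_ge => y c Kyc yx; rewrite lerBlDr [leRHS]addrC -lerBlDr.
apply: p_ge => z d Kzd zx; rewrite lerBlDr addrC.
rewrite addrC; apply: p_le (KD Kzd Kyc) _.
by rewrite reD opprD (addrC (- re x)) addrACA; exact: posD.
Qed.

Let dominated_le G x : dominated G -> G x <= p x.
Proof.
move=> [pG GK]; apply: p_ge => y c Kyc yx; rewrite -(pf_re pG).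
apply: (le_trans (pf_mono pG yx)); apply: GK => //.
by rewrite -(subrK (re x) y) adjD re_adj (pos_adj yx).
Qed.

(** [extreme_functional] applied to [p]. The middle clause expresses F x0 = p x0: the value at x0 is
    approached by constraints. *)
Lemma extreme_dominated x0 : exists F,
  [/\ dominated F,
   forall e, 0 < e -> exists y c, [/\ K (y, c), pos (y - re x0) & c < F x0 + e] &
   forall G H t, dominated G -> dominated H -> 0 < t < 1 ->
     (forall x, F x = t * G x + (1 - t) * H x) -> G = F /\ H = F].
Proof.
have [F [Fl Fp Fx0 Fext]] := extreme_functional x0 p_sublinear.
exists F; split.
- split; last first.
    move=> y c Kyc sy; apply: (le_trans (Fp y)); apply: p_le Kyc _.
    by rewrite re_sa // subrr; exact: pos0.
  (* Both properties come from the pair (0, 0): [p] is nonpositive at -x for positive x, and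
     wherever the real part vanishes. *)
  split=> // [x px|x].
    rewrite -oppr_le0 -(scalarfN Fl); apply: (le_trans (Fp _)); apply: p_le K0 _.
    by rewrite reN opprK add0r re_sa // pos_adj.
  have F_le z : re z = 0 -> F z <= 0.
    by move=> z0; apply: (le_trans (Fp _)); apply: p_le K0 _; rewrite z0 subrr; exact: pos0.
  have re0 : re (adj x - x) = 0 by rewrite /re adjB adjK addrC subrKA subrr scaler0.
  apply/eqP; rewrite -subr_eq0 -(scalarfB Fl) eq_le F_le //= -oppr_le0 -(scalarfN Fl).
  by rewrite F_le // reN re0 oppr0.
- move=> e e0; have [c [y Kyc yx] ce] := inf_adherent e0 (S_inf x0).
  by exists y, c; split => //; rewrite Fx0.
- move=> G H t dG dH t01 FE.
  apply: Fext FE => //; try by move=> x; exact: dominated_le.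
    by case: dG => -[].
  by case: dH => -[].
Qed.

End Extension.
End PositiveFunctionals.

(** * The unitization *)

Local Open Scope complex_scope.

Lemma cauchy_seq_limit (K : numFieldType) (V : completeNormedModType K) (u : nat -> V) :
  (forall e, 0 < e -> exists N, forall n, (N <= n)%N -> `|u n - u N| < e) ->
  exists l, forall e, 0 < e -> exists N, forall n, (N <= n)%N -> `|u n - l| < e.
Proof.
move=> cu; have cvu : cvg (u @ \oo).
  apply: cauchy_cvg; apply: cauchy_exP => e e0; have [N hN] := cu e e0.
  exists (u N); exists N => // n /= Nn.
  by rewrite -ball_normE /= distrC; exact: hN.
exists (lim (u @ \oo)) => e e0.
move/cvgrPdist_lt : cvu => /(_ e e0)[N _ hN].
by exists N => n Nn; rewrite distrC; exact: hN.
Qed.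

(** * Real-valued norms and the complex modulus *)

Section RealNorm.
Context (R : realType).

Definition rn (V : normedModType R[i]) (x : V) : R := complex.Re `|x|.

Lemma rnE (V : normedModType R[i]) (x : V) : `|x| = (rn x)%:C.
Proof. by rewrite /rn RRe_real // ger0_real. Qed.

Context (V : normedModType R[i]).
Implicit Types x y : V.

Lemma rn_ge0 x : 0 <= rn x.
Proof. by rewrite -ler0c -rnE. Qed.

Lemma rnD x y : rn (x + y) <= rn x + rn y.
Proof. by rewrite -lecR rmorphD /= -!rnE ler_normD. Qed.

Lemma rnZ (c : R[i]) x : rn (c *: x) = rn (c : R[i]^o) * rn x.
Proof. by apply: complexI; rewrite rmorphM /= -!rnE normrZ. Qed.

Lemma rn0_eq0 x : rn x = 0 -> x = 0.
Proof. by move=> x0; apply/eqP; rewrite -normr_eq0 rnE x0. Qed.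

Lemma rn0 : rn (0 : V) = 0. Proof. by rewrite /rn normr0. Qed.

Lemma rnN x : rn (- x) = rn x. Proof. by rewrite /rn normrN. Qed.

End RealNorm.

Section ComplexModulus.
Context (R : realType).
Implicit Types l m : R[i].

Definition cmod l : R := rn (l : R[i]^o).

Lemma cmodE l : `|l| = (cmod l)%:C. Proof. exact: (rnE (l : R[i]^o)). Qed.

Lemma cmodM l m : cmod (l * m) = cmod l * cmod m.
Proof. by apply: complexI; rewrite rmorphM /= -!cmodE normrM. Qed.

Lemma cmodJ l : cmod l^* = cmod l.
Proof. by rewrite /cmod /rn normcJ. Qed.

Lemma cmodR (t : R) : cmod t%:C = `|t|.
Proof. by rewrite /cmod /rn normc_def /= expr0n addr0 sqrtr_sqr. Qed.

Lemma cmod_sqr l : cmod l ^+ 2 = complex.Re l ^+ 2 + complex.Im l ^+ 2.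
Proof. by apply: complexI; rewrite rmorphXn /= -cmodE -add_Re2_Im2. Qed.

Lemma cmod_Re l : `|complex.Re l| <= cmod l.
Proof. by rewrite -lecR -cmodE normc_ge_Re. Qed.

Lemma cmod_Im l : `|complex.Im l| <= cmod l.
Proof.
rewrite -(ler_pXn2r (n := 2)) ?nnegrE ?rn_ge0 // cmod_sqr real_normK ?num_real //.
by rewrite lerDr sqr_ge0.
Qed.

Lemma cmod_le l : cmod l <= `|complex.Re l| + `|complex.Im l|.
Proof.
rewrite -(ler_pXn2r (n := 2)) ?nnegrE ?rn_ge0 ?addr_ge0 // cmod_sqr sqrrD.
by rewrite !real_normK ?num_real // -addrA lerD2l lerDr mulrn_wge0 // mulr_ge0.
Qed.

Lemma complex_cauchy (u : nat -> R[i]) :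
  (forall e, 0 < e -> exists N, forall n, (N <= n)%N -> cmod (u n - u N) < e) ->
  exists l, forall e, 0 < e -> exists N, forall n, (N <= n)%N -> cmod (u n - l) < e.
Proof.
move=> cu.
have [a ha] : exists a, forall e, 0 < e ->
    exists N, forall n, (N <= n)%N -> `|complex.Re (u n) - a| < e.
  apply: (@cauchy_seq_limit R R^o) => e /cu[N hN]; exists N => n /hN.
  by apply: le_lt_trans; rewrite -raddfB; exact: cmod_Re.
have [b hb] : exists b, forall e, 0 < e ->
    exists N, forall n, (N <= n)%N -> `|complex.Im (u n) - b| < e.
  apply: (@cauchy_seq_limit R R^o) => e /cu[N hN]; exists N => n /hN.
  by apply: le_lt_trans; rewrite -raddfB; exact: cmod_Im.
exists (a +i* b) => e e0.
have e2 : 0 < e / 2 by rewrite divr_gt0.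
have [N hN] := ha _ e2; have [M hM] := hb _ e2.
exists (maxn N M) => n; rewrite geq_max => /andP[/hN h1 /hM h2].
apply: (le_lt_trans (cmod_le _)); rewrite !raddfB /=.
by move: h1 h2; clear; lra.
Qed.

End ComplexModulus.

Section CStarNorm.
Context (R : realType) (C : cstarAlgType R).
Implicit Types x y : C.

Lemma rnM x y : rn (x ** y) <= rn x * rn y.
Proof. by rewrite -lecR rmorphM /= -!rnE cnormM. Qed.

Lemma rn_starM x : rn (star x ** x) = rn x ^+ 2.
Proof. by apply: complexI; rewrite rmorphXn /= -!rnE cnorm_star. Qed.

Lemma rn_star x : rn (star x) = rn x.
Proof.
suff le y : rn y <= rn (star y) by apply/le_anti; rewrite -{2}(starK x) !le.
have [->|y0] := eqVneq (rn y) 0; first exact: rn_ge0.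
have y_gt0 : 0 < rn y by rewrite lt_def y0 rn_ge0.
by rewrite -(ler_pM2r y_gt0) -expr2 -rn_starM rnM.
Qed.

Lemma cmul0r x : 0 ** x = 0.
Proof. by apply: (addrI (0 ** x)); rewrite -cmulDl !addr0. Qed.

Lemma cmulr0 x : x ** 0 = 0.
Proof. by apply: (addrI (x ** 0)); rewrite -cmulDr !addr0. Qed.

Lemma star0 : star (0 : C) = 0.
Proof. by apply: (addrI (star 0)); rewrite -starD !addr0. Qed.

Lemma starN x : star (- x) = - star x.
Proof. by apply: (addrI (star x)); rewrite -starD !subrr star0. Qed.

Lemma starZc (c : R[i]) x : star (c *: x) = conjc c *: star x.
Proof. exact: starZ. Qed.

Lemma cstar_cauchy (u : nat -> C) :
  (forall e, 0 < e -> exists N, forall n, (N <= n)%N -> rn (u n - u N) < e) ->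
  exists l, forall e, 0 < e -> exists N, forall n, (N <= n)%N -> rn (u n - l) < e.
Proof.
move=> cu; have [l hl] : exists l, forall e, 0 < e ->
    exists N, forall n, (N <= n)%N -> `|u n - l| < e.
  apply: cauchy_seq_limit => e e0.
  have eE : e = (complex.Re e)%:C by rewrite RRe_real // gtr0_real.
  have [|N hN] := cu (complex.Re e); first by rewrite -ltcR -eE.
  by exists N => n /hN; rewrite eE rnE ltcR.
exists l => e e0; have [|N hN] := hl e%:C; first by rewrite ltcR.
by exists N => n /hN; rewrite rnE ltcR.
Qed.

End CStarNorm.

Definition unitz (R : realType) (C : cstarAlgType R) := (C * R[i])%type.

(** * Algebra structure and norm of the unitization *)

Section Unitization.
Context (R : realType) (C : cstarAlgType R).
Local Notation T := (unitz C).
Implicit Types z w : T.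

HB.instance Definition _ := GRing.Zmodule.copy T (C * R[i])%type.

Definition uone : T := (0, 1).
Definition umul z w : T := (z.1 ** w.1 + z.2 *: w.1 + w.2 *: z.1, z.2 * w.2).

Let pairP z w : z.1 = w.1 -> z.2 = w.2 -> z = w.
Proof. by case: z w => [? ?] [? ?] /= -> ->. Qed.

Let umulA : associative umul.
Proof.
move=> z w v; apply: pairP => /=; last exact: mulrA.
rewrite !(cmulDl, cmulDr, cmulZl, cmulZr, scalerDr) !cmulA !scalerA.
rewrite !addrA (mulrC w.2 v.2) (mulrC z.2 v.2).
by rewrite [LHS](ACl (1*4*2*5*3*6*7)).
Qed.

Let umul1z : left_id uone umul.
Proof.
move=> z; apply: pairP => /=; last exact: mul1r.
by rewrite cmul0r add0r scale1r scaler0 addr0.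
Qed.

Let umulz1 : right_id uone umul.
Proof.
move=> z; apply: pairP => /=; last exact: mulr1.
by rewrite cmulr0 add0r scale1r scaler0 add0r.
Qed.

Let umulDl : left_distributive umul +%R.
Proof.
move=> z w v; apply: pairP => /=; last exact: mulrDl.
by rewrite cmulDl scalerDl scalerDr !addrA [LHS](ACl (1*3*5*2*4*6)).
Qed.

Let umulDr : right_distributive umul +%R.
Proof.
move=> z w v; apply: pairP => /=; last exact: mulrDr.
by rewrite cmulDr scalerDl scalerDr !addrA [LHS](ACl (1*3*5*2*4*6)).
Qed.

Let uone_neq0 : uone != 0.
Proof. by apply/eqP => -[] /eqP; rewrite oner_eq0. Qed.

HB.instance Definition _ := GRing.Zmodule_isNzRing.Build T
  umulA umul1z umulz1 umulDl umulDr uone_neq0.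

Definition uscale (t : R) z : T := (t%:C *: z.1, t%:C * z.2).

Let uscaleA a b z : uscale a (uscale b z) = uscale (a * b) z.
Proof. by apply: pairP => /=; rewrite ?scalerA ?mulrA rmorphM. Qed.

Let uscale1 : left_id 1 uscale.
Proof. by move=> z; apply: pairP; rewrite /= rmorph1 ?scale1r ?mul1r. Qed.

Let uscaleDr : right_distributive uscale +%R.
Proof. by move=> t z w; apply: pairP => /=; [exact: scalerDr|exact: mulrDr]. Qed.

Let uscaleDl z : {morph uscale^~ z : a b / a + b}.
Proof.
by move=> a b; apply: pairP; rewrite /= rmorphD; [exact: scalerDl|exact: mulrDl].
Qed.

HB.instance Definition _ := GRing.Zmodule_isLmodule.Build R T
  uscaleA uscale1 uscaleDr uscaleDl.

Let uscaleAl t z w : t *: (z * w) = t *: z * w.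
Proof.
apply: pairP => /=; last exact: mulrA.
by rewrite cmulZl !scalerDr !scalerA (mulrC w.2).
Qed.

HB.instance Definition _ := GRing.Lmodule_isLalgebra.Build R T uscaleAl.

Let uscaleAr t z w : t *: (z * w) = z * (t *: w).
Proof.
apply: pairP => /=; last exact: mulrCA.
by rewrite cmulZr !scalerDr !scalerA (mulrC z.2).
Qed.

HB.instance Definition _ := GRing.Lalgebra_isAlgebra.Build R T uscaleAr.

Definition uadj z : T := (star z.1, z.2^*).
Definition uii : T := (0, 'i).
(** Left multiplication by z on the ideal C of its unitization; [uopn] is its operator norm. *)
Definition uact z (c : C) : C := z.1 ** c + z.2 *: c.
Definition uopn z : R := sup [set rn (uact z c) | c in [set c | rn c <= 1]].
(* The operator norm alone is only a seminorm when [C] has a unit; the modulus of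
   the scalar part repairs this. *)
Definition unrm z : R := Num.max (cmod z.2) (uopn z).

Let uact_bound z c : rn c <= 1 -> rn (uact z c) <= rn z.1 + cmod z.2.
Proof.
move=> c1; apply: (le_trans (rnD _ _)); rewrite rnZ -/(cmod _).
apply: lerD; first by apply: (le_trans (rnM _ _)); rewrite ler_piMr ?rn_ge0.
by rewrite ler_piMr ?rn_ge0.
Qed.

Let uopn_has_sup z : has_sup [set rn (uact z c) | c in [set c | rn c <= 1]].
Proof.
split; first by exists (rn (uact z 0)), 0 => //=; rewrite rn0.
by exists (rn z.1 + cmod z.2) => _ [c c1 <-]; exact: uact_bound.
Qed.

Let uopn_ub z c : rn c <= 1 -> rn (uact z c) <= uopn z.
Proof. by move=> c1; apply: sup_upper_bound; [exact: uopn_has_sup|exists c]. Qed.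

Let uopn_le z K : (forall c, rn c <= 1 -> rn (uact z c) <= K) -> uopn z <= K.
Proof.
move=> h; apply: ge_sup; first by case: (uopn_has_sup z).
by move=> _ [c c1 <-]; exact: h.
Qed.

Let uactZ z (l : R[i]) c : uact z (l *: c) = l *: uact z c.
Proof. by rewrite /uact cmulZr scalerDr !scalerA mulrC. Qed.

Let uopn_ge0 z : 0 <= uopn z.
Proof. by apply: le_trans (uopn_ub z (c := 0) _); rewrite ?rn_ge0 ?rn0. Qed.

Let uact_le z c : rn (uact z c) <= uopn z * rn c.
Proof.
have [c0|c0] := eqVneq (rn c) 0.
  by rewrite c0 (rn0_eq0 c0) /uact cmulr0 scaler0 addr0 rn0 mulr0.
have c_gt0 : 0 < rn c by rewrite lt_def c0 rn_ge0.
pose k := ((rn c)^-1)%:C; have kE : rn (k : R[i]^o) = (rn c)^-1.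
  by rewrite -/(cmod _) cmodR gtr0_norm // invr_gt0.
have := @uopn_ub z (k *: c); rewrite uactZ !rnZ kE mulVf // => /(_ (lexx _)).
by rewrite mulrC ler_pdivrMr.
Qed.

Let uactM z w c : uact (z * w) c = uact z (uact w c).
Proof.
rewrite /uact /= !(cmulDl, cmulDr, cmulZl, cmulZr, scalerDr) !cmulA !scalerA !addrA.
by rewrite [LHS](ACl (1*3*2*4)).
Qed.

Let uactD z w c : uact (z + w) c = uact z c + uact w c.
Proof. by rewrite /uact /= cmulDl scalerDl addrACA. Qed.

Let unrmD z w : unrm (z + w) <= unrm z + unrm w.
Proof.
rewrite /unrm ge_max; apply/andP; split.
  apply: (le_trans (rnD (z.2 : R[i]^o) w.2)).
  by apply: lerD; rewrite le_max lexx.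
apply: uopn_le => c c1; rewrite uactD; apply: (le_trans (rnD _ _)).
by apply: lerD; rewrite le_max uopn_ub ?orbT.
Qed.

Let unrmZ t z : unrm (t *: z) = `|t| * unrm z.
Proof.
rewrite /unrm maxr_pMr //= cmodM cmodR; congr (Num.max _ _).
have le s w : uopn (s *: w) <= `|s| * uopn w.
  apply: uopn_le => c c1.
  have -> : uact (s *: w) c = s%:C *: uact w c.
    by rewrite /uact /= cmulZl scalerDr scalerA.
  by rewrite rnZ -/(cmod _) cmodR ler_wpM2l // uopn_ub.
apply/le_anti; rewrite le /=; have [->|t0] := eqVneq t 0.
  by rewrite normr0 mul0r uopn_ge0.
have := le t^-1 (t *: z); rewrite scalerA mulVf // scale1r normfV.
by rewrite mulrC ler_pdivlMr ?normr_gt0 // mulrC.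
Qed.

Let unrmM z w : unrm (z * w) <= unrm z * unrm w.
Proof.
rewrite {1}/unrm ge_max; apply/andP; split.
  by rewrite /= cmodM ler_pM ?rn_ge0 // le_max lexx.
apply: uopn_le => c c1; rewrite uactM; apply: (le_trans (uact_le _ _)).
apply: ler_pM; rewrite ?uopn_ge0 ?rn_ge0 //; first by rewrite le_max lexx orbT.
by rewrite le_max uopn_ub ?orbT.
Qed.

Let uadjK : involutive uadj.
Proof. by move=> z; apply: pairP; rewrite /= ?starK ?conjcK. Qed.

Let uadjD : {morph uadj : z w / z + w}.
Proof. by move=> z w; apply: pairP; rewrite /= ?starD ?rmorphD. Qed.

Let uadjZ t z : uadj (t *: z) = t *: uadj z.
Proof.
apply: pairP; first by rewrite [LHS]starZc conjc_real.
by rewrite [LHS]rmorphM /= oppr0.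
Qed.

Let uadjM z w : uadj (z * w) = uadj w * uadj z.
Proof.
apply: pairP => /=; last by rewrite rmorphM mulrC.
by rewrite !starD !starZc starM -!addrA; congr (_ + _); exact: addrC.
Qed.

Let star_uact z c : star (uact z c) = star c ** star z.1 + z.2^* *: star c.
Proof. by rewrite starD starM starZc. Qed.

(** If the scalar part dominates, the identity for complex numbers suffices. Otherwise, for c in the
    unit ball, the C*-identity in C bounds |zc|^2 by the norm of [uadj z * z] applied to c. *)
Let unrm_sqr_le z : unrm z ^+ 2 <= unrm (uadj z * z).
Proof.
have [h|h] := leP (uopn z) (cmod z.2); rewrite {1}/unrm.
  by rewrite max_l // le_max /= cmodM cmodJ -expr2 lexx.
rewrite max_r; last exact: ltW.
have sq : uopn z ^+ 2 <= uopn (uadj z * z).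
  have : uopn z <= Num.sqrt (uopn (uadj z * z)).
    apply: uopn_le => c c1; rewrite -(ler_pXn2r (n := 2)) ?nnegrE ?rn_ge0 ?sqrtr_ge0 //.
    rewrite sqr_sqrtr ?uopn_ge0 // -rn_starM star_uact.
    have -> : (star c ** star z.1 + z.2^* *: star c) ** uact z c =
              star c ** uact (uadj z) (uact z c).
      move: (uact z c) => w.
      by rewrite /uact /= cmulDl cmulDr cmulA cmulZl cmulZr.
    rewrite -uactM; apply: (le_trans (rnM _ _)); rewrite rn_star.
    have := uopn_ub (uadj z * z) c1; apply: le_trans.
    by rewrite ler_piMl ?rn_ge0.
  rewrite -(ler_pXn2r (n := 2)) ?nnegrE ?uopn_ge0 ?sqrtr_ge0 //.
  by rewrite sqr_sqrtr ?uopn_ge0.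
by apply: (le_trans sq); rewrite le_max lexx orbT.
Qed.

Let unrm_ge0 z : 0 <= unrm z.
Proof. by rewrite le_max uopn_ge0 orbT. Qed.

Let unrm_adj z : unrm (uadj z) = unrm z.
Proof.
suff le w : unrm w <= unrm (uadj w) by apply/le_anti; rewrite -{2}(uadjK z) !le.
have [->|y0] := eqVneq (unrm w) 0; first exact: unrm_ge0.
have w0 : 0 < unrm w by rewrite lt_def y0 unrm_ge0.
by rewrite -(ler_pM2r w0) -expr2; apply: le_trans (unrm_sqr_le _) (unrmM _ _).
Qed.

Let unrm_adjM z : unrm (uadj z * z) = unrm z ^+ 2.
Proof.
apply/le_anti; rewrite unrm_sqr_le andbT; apply: (le_trans (unrmM _ _)).
by rewrite unrm_adj.
Qed.

(** Left multiplication by x is tested on [star x], where the C*-identity gives |x|^2. *)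
Let rn_le_uopn x : rn x <= uopn (x, 0).
Proof.
have := uact_le (x, 0) (star x); rewrite /uact /= scale0r addr0.
rewrite -{1}(starK x) rn_starM rn_star expr2.
have [->|x0] := eqVneq (rn x) 0; first by rewrite uopn_ge0.
by rewrite ler_pM2r // lt_def x0 rn_ge0.
Qed.

(** Together with [unrm_le] this compares [unrm] with the coordinates, from which completeness is
    inherited. *)
Let rn_le_unrm z : rn z.1 <= 2 * unrm z.
Proof.
apply: (le_trans (rn_le_uopn _)); apply: uopn_le => c c1.
have -> : uact (z.1, 0) c = uact z c - z.2 *: c by rewrite /uact /= scale0r addr0 addrK.
apply: (le_trans (rnD _ _)); rewrite rnN rnZ -/(cmod _).
have : rn (uact z c) <= unrm z by rewrite le_max uopn_ub ?orbT.
have : cmod z.2 * rn c <= unrm z.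
  by apply: (@le_trans _ _ (cmod z.2)); rewrite ?ler_piMr ?rn_ge0 // le_max lexx.
by lra.
Qed.

Let cmod_le_unrm z : cmod z.2 <= unrm z. Proof. by rewrite le_max lexx. Qed.

Let unrm_le z : unrm z <= rn z.1 + cmod z.2.
Proof.
rewrite ge_max lerDr rn_ge0 /=; apply: uopn_le => c; exact: uact_bound.
Qed.

Let unrm0_eq0 z : unrm z = 0 -> z = 0.
Proof.
move=> h; apply: pairP => /=.
  by apply: rn0_eq0; apply/le_anti; rewrite rn_ge0 andbT -(mulr0 2) -h rn_le_unrm.
apply: (@rn0_eq0 R R[i]^o); apply/le_anti.
by rewrite rn_ge0 andbT -h cmod_le_unrm.
Qed.

Let unrm_complete (u : nat -> T) :
  (forall e, 0 < e -> exists N, forall n, (N <= n)%N -> unrm (u n - u N) < e) ->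
  exists l, forall e, 0 < e -> exists N, forall n, (N <= n)%N -> unrm (u n - l) < e.
Proof.
move=> cu; have [|x hx] := @cstar_cauchy R C (fun n => (u n).1).
  move=> e e0; have [|N hN] := cu (e / 2); first by rewrite divr_gt0.
  exists N => n /hN; have := rn_le_unrm (u n - u N) => /=; lra.
have [|l hl] := @complex_cauchy R (fun n => (u n).2).
  move=> e e0; have [N hN] := cu _ e0.
  by exists N => n /hN; apply: le_lt_trans; exact: cmod_le_unrm (u n - u N).
exists (x, l) => e e0; have e2 : 0 < e / 2 by rewrite divr_gt0.
have [N hN] := hx _ e2; have [M hM] := hl _ e2.
exists (maxn N M) => n; rewrite geq_max => /andP[/hN h1 /hM h2].
apply: (le_lt_trans (unrm_le _)) => /=.
by lra.
Qed.

Let uiiC z : uii * z = z * uii.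
Proof.
apply: pairP => /=; last exact: mulrC.
by rewrite cmul0r cmulr0 scaler0 addr0 !add0r.
Qed.

Let uiiii : uii * uii = - 1.
Proof.
apply: pairP => /=; first by rewrite cmul0r !scaler0 !addr0 oppr0.
exact: sqr_i.
Qed.

Let uadj_ii : uadj uii = - uii.
Proof.
apply: pairP; first by rewrite /= star0 oppr0.
by apply/eqP; rewrite eq_complex /= oppr0 !eqxx.
Qed.

HB.instance Definition _ := Algebra_isUnitalCStar.Build R T unrmD unrmZ unrm0_eq0
  unrmM unrm_adjM unrm_complete uadjK uadjD uadjZ uadjM uiiC uiiii uadj_ii.

Lemma unrm_pair0 (x : C) : nrm ((x, 0) : T) = rn x.
Proof.
apply/le_anti/andP; split.
  by apply: (le_trans (unrm_le _)); rewrite [cmod _]rn0 addr0.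
by apply: (le_trans (rn_le_uopn _)); rewrite le_max lexx orbT.
Qed.

End Unitization.

(** * States *)

Section Embedding.
Context (R : realType) (C : cstarAlgType R).
Implicit Types (x y a : C) (z w : unitz C).

Definition emb a : unitz C := (a, 0).

Lemma unitzP z w : z.1 = w.1 -> z.2 = w.2 -> z = w.
Proof. by case: z w => [? ?] [? ?] /= -> ->. Qed.

Lemma nrm_emb a : nrm (emb a) = rn a. Proof. exact: unrm_pair0. Qed.

Lemma emb_inj : injective emb. Proof. by move=> a b []. Qed.

Lemma embD x y : emb (x + y) = emb x + emb y.
Proof. by apply: unitzP; rewrite /= ?addr0. Qed.

Lemma embN x : emb (- x) = - emb x.
Proof. by apply: unitzP; rewrite /= ?oppr0. Qed.

Lemma embB x y : emb (x - y) = emb x - emb y.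
Proof. by rewrite embD embN. Qed.

Lemma emb0 : emb 0 = 0. Proof. by []. Qed.

Lemma embM x y : emb (x ** y) = emb x * emb y.
Proof. by apply: unitzP; rewrite /= ?mulr0 // !scale0r !addr0. Qed.

Lemma embZ (t : R) x : emb (t%:C *: x) = t *: emb x.
Proof. by apply: unitzP; rewrite /= ?mulr0. Qed.

Lemma emb_star x : emb (star x) = adj (emb x).
Proof. by apply: unitzP => //; exact/esym/conjc0. Qed.

Lemma embi x : emb ('i%C *: x) = ii * emb x.
Proof. by apply: unitzP; rewrite /= ?mulr0 // cmul0r add0r scale0r addr0. Qed.

Lemma embC (c : R[i]) x :
  emb (c *: x) = complex.Re c *: emb x + complex.Im c *: emb ('i%C *: x).
Proof.
by rewrite {1}[c]complexE scalerDl embD embZ mulrC -scalerA embZ.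
Qed.

Lemma emb_eq z : z.2 = 0 -> z = emb z.1.
Proof. by move=> z2; apply: unitzP. Qed.

Lemma unitz_decomp z :
  z = emb z.1 + (complex.Re z.2)%:A + complex.Im z.2 *: (ii : unitz C).
Proof.
apply: unitzP => /=; first by rewrite !scaler0 !addr0.
by rewrite add0r mulr1 mulrC -complexE.
Qed.

Lemma pos_snd z : pos z -> 0 <= z.2.
Proof.
move=> /pos_sqrt[b [/pos_adj sb <- _]]; rewrite -{1}sb /= mulrC; exact: mulcJ_ge0.
Qed.

(** The scalar part of a square root of (a, 0) squares to 0, so the root lies in C; this ties
    [positive] to the spectral notion [pos]. *)
Lemma positive_emb a : positive a <-> pos (emb a).
Proof.
split=> [[b ->]|/pos_sqrt[b [/pos_adj sb ba _]]].
  by rewrite embM emb_star; exact: pos_adjM.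
have b2 : b.2 = 0 by move/(congr1 snd): ba => /= /eqP; rewrite mulf_eq0 orbb => /eqP.
exists b.1; apply: emb_inj.
by rewrite embM emb_star -(emb_eq b2) sb.
Qed.

Lemma star_emb a : star a = a -> adj (emb a) = emb a.
Proof. by move=> sa; rewrite -emb_star sa. Qed.

Lemma jordan_emb a : star a = a -> exists p n : C,
  [/\ positive p, positive n, a = p - n, p ** n = 0 & n ** p = 0].
Proof.
move=> /star_emb /jordan[p [n [pp pn aE pn0 np0]]].
have e : p.2 = n.2.
  by move/(congr1 snd): aE => /= /esym/eqP; rewrite subr_eq0 => /eqP.
have n2 : n.2 = 0.
  by move/(congr1 snd): np0 => /= /eqP; rewrite e mulf_eq0 orbb => /eqP.
have p2 : p.2 = 0 by rewrite e.
rewrite (emb_eq n2) (emb_eq p2) in pp pn aE pn0 np0.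
exists p.1, n.1; split; try exact/positive_emb.
- by apply: emb_inj; rewrite embB.
- by apply: emb_inj; rewrite embM.
- by apply: emb_inj; rewrite embM.
Qed.

(** For z = y + k >= 0 and y = p - n, the inequality n - p <= k bounds the norm of n by k. This
    later yields positivity of [ext] without approximate units. *)
Lemma pos_decomp z : pos z -> exists p n : C,
  [/\ positive p, positive n, z = emb p - emb n + (complex.Re z.2)%:A &
    rn n <= complex.Re z.2].
Proof.
move=> pz; have sz := pos_adj pz.
have /jordan_emb[p [n [pp pn zE pn0 np0]]] : star z.1 = z.1 by move/(congr1 fst): sz.
have := pos_snd pz; case: z pz {sz} zE => y l pz /= yE l0.
have lE : l = (complex.Re l)%:C by rewrite RRe_real // ger0_real.
set k := complex.Re l in lE *; have k0 : 0 <= k by rewrite -ler0c -lE.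
exists p, n; split => //.
  apply: unitzP => /=; first by rewrite scaler0 addr0 yE.
  by rewrite subrr add0r mulr1.
rewrite -nrm_emb; apply: (@nrm_pospart _ _ _ (emb p)) => //.
- exact/positive_emb.
- exact/positive_emb.
- by rewrite -embM np0.
- by rewrite -embM pn0.
- suff -> : k%:A - (emb n - emb p) = (y, l) by [].
  apply: unitzP => /=; first by rewrite scaler0 add0r opprB yE.
  by rewrite mulr1 subr0 subr0.
Qed.

End Embedding.

Section States.
Context (R : realType) (C : cstarAlgType R).
Implicit Types (x y a : C) (z w : unitz C) (f g : C -> R[i]) (F : unitz C -> R).

Lemma rotate (l : R[i]) : exists2 u : R[i], cmod u <= 1 & u * l = (cmod l)%:C.
Proof.
have [->|l0] := eqVneq l 0; first by exists 0; rewrite ?mulr0 [cmod _]rn0.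
have m0 : cmod l != 0 by apply: contra_neq l0; exact: (@rn0_eq0 R R[i]^o).
exists (conjc l / (cmod l)%:C).
  rewrite cmodM cmodJ -fmorphV cmodR ger0_norm ?invr_ge0 ?rn_ge0 //.
  by rewrite divff.
rewrite mulrAC (mulrC (conjc l)) -sqr_normc cmodE expr2 mulfK //.
by apply: contra_neq m0 => /complexI.
Qed.

Lemma state_bound f a : state f -> cmod (f a) <= rn a.
Proof.
move=> [fl _ fn]; have [a0|a0] := eqVneq (rn a) 0.
  by rewrite a0 (rn0_eq0 a0) (scalarf0 fl) [cmod _]rn0.
have {}a0 : 0 < rn a by rewrite lt_def a0 rn_ge0.
pose k := ((rn a)^-1)%:C : R[i].
have kE : cmod k = (rn a)^-1 by rewrite cmodR gtr0_norm // invr_gt0.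
have h : `|k *: a| <= 1.
  by rewrite rnE rnZ -/(cmod _) kE mulVf ?gt_eqF.
have : ((cmod (f (k *: a)))%:E <= functional_norm f)%E.
  by apply: ereal_sup_ubound; exists (k *: a).
by rewrite fn lee_fin (scalarfZ fl) cmodM kE mulrC ler_pdivrMr // mul1r.
Qed.

Lemma state_sup f e : state f -> 0 < e -> exists2 a : C, rn a <= 1 & 1 - e < complex.Re (f a).
Proof.
move=> [fl _ fn] e0.
have : ((1 - e)%:E < functional_norm f)%E by rewrite fn lte_fin; lra.
move=> /ereal_sup_gt[_ [a /= a1 <-]]; rewrite lte_fin => h.
have [u u1 uE] := rotate (f a); exists (u *: a); last by rewrite (scalarfZ fl) uE.
rewrite rnZ -/(cmod u) mulr_ile1 ?rn_ge0 //.
by move: a1; rewrite rnE lecR.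
Qed.

Lemma state_Im f a : state f -> star a = a -> complex.Im (f a) = 0.
Proof.
move=> [fl fp _] /jordan_emb[p [n [pp pn -> _ _]]].
by rewrite (scalarfB fl) raddfB /= (ger0_Im (fp _ pp)) (ger0_Im (fp _ pn)) subrr.
Qed.

(** The real part of the extension of f to the unitization with value 1 at the unit. *)
Definition ext f z : R := complex.Re (f z.1) + complex.Re z.2.

Lemma ext_emb f a : ext f (emb a) = complex.Re (f a).
Proof. by rewrite /ext addr0. Qed.

Lemma ext1 f : state f -> ext f 1 = 1.
Proof. by case=> fl _ _; rewrite /ext /= (scalarf0 fl) add0r. Qed.

Lemma Re_real (t : R) (l : R[i]) : complex.Re (t%:C * l) = t * complex.Re l.
Proof. by case: l => a b /=; rewrite mul0r subr0. Qed.

(** On z = p - n + k >= 0 one has f(p) >= 0 and |f(n)| <= |n| <= k. Invariance under the adjoint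
    holds because f is real on the self-adjoint element i(star x - x). *)
Lemma ext_positive f : state f -> positive_functional (ext f).
Proof.
move=> fs; have [fl fp _] := fs; split.
- move=> t z w; rewrite /ext /= (scalarfD fl) (scalarfZ fl) !raddfD /= !Re_real; lra.
- move=> z /pos_decomp[p [n [pp pn zE nk]]].
  have z1 : z.1 = p - n by rewrite zE /= scaler0 addr0.
  rewrite /ext z1 (scalarfB fl) raddfB /=.
  have := cmod_Re (f n); rewrite ler_norml => /andP[_].
  have := state_bound n fs; have := fp _ pp; rewrite lecE => /andP[_] /=.
  lra.
- move=> z; rewrite /ext /=; congr (_ + _); last by case: (z.2).
  set x := z.1; apply/eqP; rewrite -subr_eq0 -raddfB -(scalarfB fl); apply/eqP.
  have : complex.Im (f ('i%C *: (star x - x))) = 0.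
    apply: state_Im => //; rewrite starZc starD starN starK.
    have -> : conjc 'i%C = - 'i%C :> R[i] by apply/eqP; rewrite eq_complex /= oppr0 !eqxx.
    by rewrite scaleNr -scalerN opprB.
  by rewrite (scalarfZ fl) (mulrC 'i%C) ImiRe.
Qed.

Lemma state_eq f g : state f -> state g ->
  (forall a, complex.Re (f a) = complex.Re (g a)) -> f = g.
Proof.
move=> [fl _ _] [gl _ _] h; apply/funext => a; apply/eqP; rewrite eq_complex h eqxx /=.
have := h ('i%C *: a); rewrite (scalarfZ fl) (scalarfZ gl) !(mulrC 'i%C) !ReiNIm.
by move=> /oppr_inj ->.
Qed.

(** Recovers a complex functional from its real part F as F(a) - iF(ia). *)
Definition complexify F a : R[i] := F (emb a) +i* - F (emb ('i%C *: a)).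

Lemma pf_ii F : positive_functional F -> F ii = 0.
Proof.
move=> [Fl _ Fa]; have := Fa ii; rewrite adj_ii (scalarfN Fl); lra.
Qed.

Lemma pf_decomp F z : positive_functional F ->
  F z = F (emb z.1) + complex.Re z.2 * F 1.
Proof.
move=> pF; have [Fl _ _] := pF.
by rewrite {1}(unitz_decomp z) !(scalarfD Fl) !(scalarfZ Fl) pf_ii // mulr0 addr0.
Qed.

Lemma ext_complexify F : positive_functional F -> F 1 = 1 -> ext (complexify F) = F.
Proof. by move=> pF F1; apply/funext => z; rewrite [RHS]pf_decomp // F1 mulr1. Qed.

Lemma complexify_ext f : scalar f -> complexify (ext f) = f.
Proof.
move=> fl; apply/funext => a; rewrite /complexify !ext_emb (scalarfZ fl) (mulrC 'i%C) ReiNIm opprK.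
by case: (f a).
Qed.

(** The last hypothesis keeps the norm from dropping: sending z to Re z.2 is positive with value 1
    at the unit, and yet vanishes on C. *)
Lemma complexify_state F : positive_functional F -> F 1 <= 1 ->
  (forall e, 0 < e -> exists2 a : C, rn a <= 1 & 1 - e < F (emb a)) ->
  state (complexify F).
Proof.
move=> pF F1 Fsup; have [Fl Fp Fa] := pF.
have cl : scalar (complexify F).
  move=> c x y; rewrite /complexify !scalerDr (scalerA 'i%C) (mulrC 'i%C) -scalerA.
  rewrite !embD !(embC c) (scalerA 'i%C) -expr2 sqr_i scaleN1r embN.
  rewrite !(scalarfD Fl) !(scalarfZ Fl) (scalarfN Fl).
  by apply/eqP; rewrite eq_complex; case: c => s t /=; apply/andP; split; apply/eqP; ring.
split => //.
- move=> a /positive_emb pa; rewrite lecE /= Fp // andbT oppr_eq0.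
  have := Fa (ii * emb a); rewrite adjM (pos_adj pa) adj_ii mulrN -iiC (scalarfN Fl) -embi.
  by move=> h; apply/eqP; lra.
- apply/le_anti/andP; split.
    apply: ub_ereal_sup => _ [a /= a1 <-]; rewrite lee_fin -/(cmod _).
    have [u u1 uE] := rotate (complexify F a).
    rewrite -[leLHS]/(complex.Re (cmod (complexify F a))%:C) -uE -(scalarfZ cl) /=.
    apply: (le_trans (pf_le pF _)); rewrite nrm_emb rnZ.
    rewrite mulr_ile1 ?mulr_ge0 ?rn_ge0 ?(pf1_ge0 pF) //.
    by rewrite mulr_ile1 ?rn_ge0 // -lecR -rnE.
  apply/lee_addgt0Pr => e e0; have [a a1 ha] := Fsup e e0.
  rewrite -leeBlDr //; apply: (@le_trans _ _ (cmod (complexify F a))%:E).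
    rewrite -EFinB lee_fin ltW //; apply: (lt_le_trans ha).
    exact: le_trans (ler_norm _) (cmod_Re (complexify F a)).
  by apply: ereal_sup_ubound; exists a => //=; rewrite rnE lecR.
Qed.

End States.

(** * Inclusions: spectral permanence and extension of states *)

Section Inclusion.
Context (R : realType) (B : cstarAlgType R) (A : csubalg B).
Implicit Types (a b : A) (z w : unitz A).
Local Notation incl := (@csub_incl R B A).

Lemma inclZ (c : R[i]) a : incl (c *: a) = c *: incl a. Proof. by []. Qed.

Lemma incl_inj : injective incl. Proof. exact: val_inj. Qed.

Definition umap z : unitz B := (incl z.1, z.2).

Lemma umap_inj : injective umap.
Proof. by move=> [a l] [b m] [/incl_inj -> ->]. Qed.

Lemma umapD z w : umap (z + w) = umap z + umap w. Proof. by []. Qed.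
Lemma umapN z : umap (- z) = - umap z. Proof. by []. Qed.
Lemma umapB z w : umap (z - w) = umap z - umap w. Proof. by []. Qed.
Lemma umapZ (t : R) z : umap (t *: z) = t *: umap z. Proof. by []. Qed.
Lemma umapM z w : umap (z * w) = umap z * umap w. Proof. by []. Qed.
Lemma umap1 : umap 1 = 1. Proof. by []. Qed.
Lemma umap0 : umap 0 = 0. Proof. by []. Qed.
Lemma umap_adj z : umap (adj z) = adj (umap z). Proof. by []. Qed.
Lemma umap_emb a : umap (emb a) = emb (incl a). Proof. by []. Qed.

Lemma umap_pos z : pos z -> pos (umap z).
Proof.
by move=> /pos_sqrt[b [/pos_adj sb <- _]]; rewrite -{1}sb umapM umap_adj; exact: pos_adjM.
Qed.

(** Let n be the negative part of z. In the larger algebra nzn = -n^3 is positive, and so is n^3;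
    hence n = 0. *)
Lemma pos_umap z : pos (umap z) <-> pos z.
Proof.
split=> [pz|]; last exact: umap_pos.
have /jordan[p [n [pp pn zE pn0 np0]]] : adj z = z.
  by apply: umap_inj; rewrite umap_adj pos_adj.
have sn := pos_adj pn; have sun : adj (umap n) = umap n by rewrite -umap_adj sn.
have n3 : umap n * umap n * umap n = 0.
  apply: pos_anti; first by apply: pos_conj_sa => //; exact: umap_pos.
  have := pos_conj_sa sun pz; rewrite {1}zE umapB mulrBr mulrBl -!umapM np0 mul0r umap0.
  by rewrite sub0r.
have n2 : n * n = 0.
  apply: sqr_eq0; first by rewrite adjM sn.
  by rewrite mulrA; apply: umap_inj; rewrite umapM !umapM n3 mul0r.
by rewrite zE (sqr_eq0 sn n2) subr0.
Qed.

(** The constraints form the graph of [ext phi]; used at y and -y they force equality. The extension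
    is as large as possible at x0, so its value there is approached by [ext phi] on elements above
    [re x0]. *)
Lemma state_extension (phi : A -> R[i]) (x0 : unitz B) : state phi ->
  exists psi : B -> R[i], [/\ state psi, forall a, psi (incl a) = phi a &
    forall e, 0 < e -> exists y, pos (umap y - re x0) /\ ext phi y < ext psi x0 + e].
Proof.
move=> phis; have pe := ext_positive phis; have [el ep ea] := pe.
pose K : set (unitz B * R) := [set yc | exists y, yc = (umap y, ext phi y)].
have [|||||F [[pF FK] Fx0 _]] := @extreme_dominated R (unitz B) K _ _ _ _ _ x0.
- by exists 0; rewrite umap0 (scalarf0 el).
- move=> _ _ _ _ [y [-> ->]] [z [-> ->]]; exists (y + z).
  by rewrite umapD (scalarfD el).
- move=> t _ _ _ [y [-> ->]]; exists (t *: y).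
  by rewrite umapZ (scalarfZ el).
- by exists (ext phi 1), 1.
- by move=> _ _ [y [-> ->]] /pos_umap; exact: ep.
have [Fl Fp Fa] := pF.
have Fsa y : adj y = y -> F (umap y) <= ext phi y.
  by move=> sy; apply: FK; [exists y|rewrite -umap_adj sy].
have Fu y : F (umap y) = ext phi y.
  rewrite -(pf_re pF) -(pf_re pe).
  have -> : re (umap y) = umap (re y) by [].
  apply/le_anti; rewrite Fsa ?re_adj //= -lerN2 -(scalarfN Fl) -(scalarfN el) -umapN.
  by apply: Fsa; rewrite adjN re_adj.
have F1 : F 1 = 1 by rewrite -umap1 Fu ext1.
exists (complexify F); split.
- apply: complexify_state => //; first by rewrite F1.
  move=> e /(state_sup phis)[a a1 ha]; exists (incl a) => //.
  by rewrite -umap_emb Fu ext_emb.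
- move=> a; rewrite /complexify -inclZ -!umap_emb !Fu.
  by rewrite -[LHS]/(complexify (ext phi) a) complexify_ext //; case: phis.
- move=> e e0; have [_ [_ [[y [-> ->]] yx ce]]] := Fx0 e e0.
  by exists y; rewrite ext_complexify.
Qed.

End Inclusion.

(** * Order properties of pure states *)

Section PureStates.
Context (R : realType) (C : cstarAlgType R).
Implicit Types (f g phi : C -> R[i]) (F G : unitz C -> R) (y z : unitz C).

Lemma positive_functionalZ F t : 0 <= t -> positive_functional F ->
  positive_functional (fun z => t * F z).
Proof.
move=> t0 [Fl Fp Fa]; split=> [a x y|x px|x]; last by rewrite Fa.
- by rewrite Fl; ring.
- by rewrite mulr_ge0 ?Fp.
Qed.

Lemma pf_eq_const F x : positive_functional F -> F 1 = 0 -> F x = 0.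
Proof.
move=> pF F1; have [Fl _ _] := pF.
have := pf_le pF x; have := pf_le pF (- x); rewrite F1 !mulr0 (scalarfN Fl); lra.
Qed.

(** Since G(a) <= G(1) on the unit ball, F(a) is close to F(1) wherever phi(a) is close to 1. *)
Lemma summand_state phi F G : state phi -> positive_functional F ->
  positive_functional G -> (forall z, F z + G z = ext phi z) -> 0 < F 1 ->
  state (complexify (fun z => (F 1)^-1 * F z)).
Proof.
move=> ps pF pG FG F1; apply: complexify_state.
- by apply: positive_functionalZ => //; rewrite invr_ge0 ltW.
- by rewrite mulVf ?gt_eqF.
move=> e e0; have [a a1 ha] := state_sup ps (mulr_gt0 e0 F1).
exists a => //; rewrite mulrC ltr_pdivlMr //.
have := FG 1; rewrite (ext1 ps) => FG1.
have := FG (emb a); rewrite ext_emb => FGa.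
have : G (emb a) <= G 1.
  apply: (le_trans (pf_le pG _)); rewrite nrm_emb ler_piMl //.
  by case: pG => _ + _; apply; exact: pos1.
lra.
Qed.

(* A functional dominated by a pure state is a multiple of it. *)
Lemma pure_dominated phi F : pure_state phi -> positive_functional F ->
  (forall z, pos z -> F z <= ext phi z) -> forall z, F z = F 1 * ext phi z.
Proof.
move=> [ps pure] pF FK z; have pe := ext_positive ps; have [Fl Fp Fa] := pF.
have [el ep ea] := pe; pose G w := ext phi w - F w.
have pG : positive_functional G.
  split=> [t x y|x px|x]; rewrite /G; first by rewrite el Fl; ring.
    by rewrite subr_ge0 FK.
  by rewrite Fa ea.
have FG w : F w + G w = ext phi w by rewrite /G addrC subrK.
have G1 : G 1 = 1 - F 1 by rewrite /G ext1.
have := Fp _ (@pos1 _ _); rewrite le_eqVlt => /predU1P[F0|F0].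
  by rewrite -F0 mul0r pf_eq_const.
have : 0 <= G 1 by case: pG => _ + _; apply; exact: pos1.
rewrite le_eqVlt => /predU1P[G0|G0].
  have -> : F 1 = 1 by lra.
  by rewrite -FG (pf_eq_const _ pG) // addr0 mul1r.
have sF := summand_state ps pF pG FG F0.
have GF w : G w + F w = ext phi w by rewrite addrC FG.
have sG := summand_state ps pG pF GF G0.
have F01 : 0 < F 1 < 1 by rewrite F0 /=; lra.
have [|e _] := pure _ _ _ sF sG F01.
  move=> a; rewrite -[in LHS](complexify_ext (let: And3 h _ _ := ps in h)).
  rewrite /complexify -!FG -G1; apply/eqP; rewrite eq_complex /=.
  rewrite !mul0r !subr0 !addr0 !mulrN !mulrA !divff ?(gt_eqF F0) ?(gt_eqF G0) //.
  by rewrite !mul1r -opprD !eqxx.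
have := congr1 (fun f => ext f z) e; rewrite ext_complexify.
- by move=> <-; rewrite mulrA divff ?gt_eqF // mul1r.
- by apply: positive_functionalZ => //; rewrite invr_ge0 ltW.
- by rewrite mulVf ?gt_eqF.
Qed.

(* By Hahn-Banach the infimum of [ext phi h] over [h >= 0, y] is attained by a
   functional dominated by [ext phi], hence a multiple of it. *)
Lemma pure_sup phi y e : pure_state phi -> adj y = y -> 0 < e ->
  exists h, [/\ pos h, pos (h - y) & ext phi h < Num.max 0 (ext phi y) + e].
Proof.
move=> /[dup] pphi [ps _] sy e0; have pe := ext_positive ps; have [el ep ea] := pe.
pose K : set (unitz C * R) := [set hc | pos hc.1 /\ hc.2 = ext phi hc.1].
have [|||||F [[pF FK] Fx0 _]] := @extreme_dominated R (unitz C) K _ _ _ _ _ y.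
- by split; [exact: pos0|rewrite /= (scalarf0 el)].
- move=> x c z d [/= px ->] [/= pz ->]; split; first exact: posD.
  by rewrite /= (scalarfD el).
- move=> t x c t0 [/= px ->]; split; first by apply: posZ => //; exact: ltW.
  by rewrite /= (scalarfZ el).
- by exists (ext phi 1); split => //; exact: pos1.
- by move=> x c [/= px ->] _; exact: ep.
have Fe z : pos z -> F z <= ext phi z by move=> pz; apply: FK; [split|exact: pos_adj].
have [h [_ [[/= ph ->] hy hF]]] := Fx0 e e0.
exists h; rewrite re_sa // in hy; split => //; apply: (lt_le_trans hF); rewrite lerD2r.
rewrite (pure_dominated pphi pF Fe).
have F1 : F 1 <= 1 by rewrite -(ext1 ps); apply/Fe/pos1.
have [h0|h0] := leP 0 (ext phi y).
  by rewrite ler_piMl.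
by rewrite mulr_ge0_le0 ?(pf1_ge0 pF) // ltW.
Qed.

(** By induction: to h add a positive k >= y - h of small value; the maximum in [pure_sup] is 0
    because phi(y - h) <= 0. *)
Lemma pure_sup_seq phi (ys : seq (unitz C)) e : pure_state phi ->
  (forall y, y \in ys -> adj y = y /\ ext phi y <= 0) -> 0 < e ->
  exists h, [/\ pos h, forall y, y \in ys -> pos (h - y) & ext phi h < e].
Proof.
move=> pphi; have [ps _] := pphi; have [el ep ea] := ext_positive ps.
elim: ys e => [|y ys IH] e ysP e0.
  by exists 0; split => //; [exact: pos0|rewrite (scalarf0 el)].
have e2 : 0 < e / 2 by rewrite divr_gt0.
have [|h [ph hys he]] := IH (e / 2) _ e2.
  by move=> z zys; apply: ysP; rewrite in_cons zys orbT.
have [sy y0] := ysP y (mem_head _ _).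
have [|k [pk kyh ke]] := @pure_sup phi (y - h) (e / 2) pphi _ e2.
  by rewrite adjB sy pos_adj.
exists (h + k); split; first exact: posD.
  move=> z; rewrite in_cons => /predU1P[->|/hys pz].
    by move: kyh; rewrite opprB addrCA addrA.
  by rewrite addrAC; exact: posD.
rewrite (scalarfD el); move: ke; rewrite (scalarfB el) max_l; first by lra.
by rewrite subr_le0; apply: le_trans y0 (ep _ ph).
Qed.

End PureStates.

(** * Pure states vanishing on a sequence; annihilators *)

Section Faces.
Context (R : realType) (C : cstarAlgType R).
Implicit Types (phi : C -> R[i]) (y z : unitz C).

(** The constraints F y <= c for y <= c + t s_k force F 1 = 1 and F(s_k) = 0, and every state
    vanishing on all s_k satisfies them; so an extreme solution that is a state is pure. *)
Lemma pure_state_on_face (s : nat -> unitz C) :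
  (forall k, pos (s k)) -> (forall k, pos (s k.+1 - s k)) ->
  (forall k, exists2 b, b != 0 & b * s k = 0) ->
  (exists k, 0 < complex.Re (s k).2) ->
  exists phi : C -> R[i], pure_state phi /\ forall k, ext phi (s k) = 0.
Proof.
move=> ps sS sb [k0 sk0].
have sle i j : (i <= j)%N -> pos (s j - s i).
  move=> /subnKC <-; elim: (j - i)%N => [|m IH]; first by rewrite addn0 subrr; exact: pos0.
  by rewrite addnS; have := posD (sS (i + m)%N) IH; rewrite addrA subrK.
pose K : set (unitz C * R) :=
  [set yc | exists k t, 0 <= t /\ pos (yc.2%:A + t *: s k - yc.1)].
have Kle y c k t : 0 <= t -> pos (c%:A + t *: s k - y) -> K (y, c) by exists k, t.
have [|||||F [[pF FK] _ Fext]] := @extreme_dominated R (unitz C) K _ _ _ _ _ 0.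
- by apply: (@Kle _ _ 0%N 0) => //; rewrite !scale0r !addr0 subr0; exact: pos0.
- move=> y c z d [i [t [/= t0 pi]]] [j [u [/= u0 pj]]].
  apply: (@Kle _ _ (maxn i j) (t + u)); first exact: addr_ge0.
  have -> : (c + d)%:A + (t + u) *: s (maxn i j) - (y + z) =
      (c%:A + t *: s i - y) + (d%:A + u *: s j - z) +
      (t *: (s (maxn i j) - s i) + u *: (s (maxn i j) - s j)).
    rewrite !scalerBr !scalerDl opprD !addrA.
    by rewrite [RHS](ACl (1*4*7*9*3*6*2*8*5*10)) /= !addrK.
  apply: posD; first exact: posD.
  by apply: posD; apply: posZ => //; apply: sle; rewrite ?leq_maxl ?leq_maxr.
- move=> r y c r0 [i [t [/= t0 pi]]]; apply: (@Kle _ _ i (r * t)).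
    by rewrite mulr_ge0 // ltW.
  by rewrite -!scalerA -scalerDr -scalerBr; apply: posZ => //; exact: ltW.
- exists 1; apply: (@Kle _ _ 0%N 0) => //.
  by rewrite scale0r addr0 scale1r subrr; exact: pos0.
- move=> y c [k [t [/= t0 pk]]] py; rewrite leNgt; apply/negP => c0.
  (* Consistency: compressing 0 <= y <= c + t s_k by b gives c times [b * adj b] positive,
     impossible for c < 0 and nonzero b. *)
  have [b b0 bs] := sb k.
  have := posD pk py; rewrite subrK => /(pos_conj (adj b)); rewrite adjK.
  rewrite mulrDr mulrDl -scalerAr -scalerAr -!scalerAl bs mul0r scaler0 addr0 mulr1 => h.
  have : adj (adj b) * adj b = 0.
    rewrite adjK; apply: pos_anti; first by rewrite -{1}[b]adjK; exact: pos_adjM.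
    have c' : 0 <= (- c)^-1 by rewrite invr_ge0 oppr_ge0 ltW.
    have := posZ c' h; rewrite scalerA invrN mulNr mulVf ?scaleN1r //.
    by rewrite lt_eqF.
  by move=> /adjM_eq0/(congr1 adj); rewrite adjK adj0 => /eqP; rewrite (negbTE b0).
have [Fl Fp Fa] := pF.
have F1 : F 1 = 1.
  apply/le_anti/andP; split.
    apply: FK; last exact: adj1.
    apply: (@Kle _ _ 0%N 0) => //.
    by rewrite scale0r addr0 scale1r subrr; exact: pos0.
  rewrite -lerN2 -(scalarfN Fl); apply: FK; last by rewrite adjN adj1.
  apply: (@Kle _ _ 0%N 0) => //.
  by rewrite scale0r addr0 opprK scaleN1r addNr; exact: pos0.
have Fs k : F (s k) = 0.
  apply/le_anti; rewrite Fp // andbT; apply: FK; last exact: pos_adj.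
  apply: (@Kle _ _ k 1) => //.
  by rewrite scale0r add0r scale1r subrr; exact: pos0.
(* F has norm 1 on C: if F <= 1 - e on the unit ball, then s_k0 = p - n + l with |n| <= l and l > 0
   gives F(s_k0) >= e l > 0. *)
have sF : state (complexify F).
  apply: complexify_state; rewrite ?F1 // => e e0.
  apply: contrapT => /forall2NP Fe.
  have Fq (a : C) : rn a <= 1 -> F (emb a) <= 1 - e.
    by move=> a1; rewrite leNgt; apply/negP; case: (Fe a).
  have q0 : 0 <= 1 - e by have := Fq 0; rewrite rn0 (scalarf0 Fl) => /(_ ler01).
  have Fqn (a : C) : F (emb a) <= (1 - e) * rn a.
    have [a0|a0] := eqVneq (rn a) 0.
      by rewrite a0 (rn0_eq0 a0) (scalarf0 Fl) mulr0.
    have {}a0 : 0 < rn a by rewrite lt_def a0 rn_ge0.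
    have := Fq ((rn a)^-1%:C *: a); rewrite embZ (scalarfZ Fl) mulrC ler_pdivrMr //.
    apply; rewrite rnZ -/(cmod _) cmodR gtr0_norm ?invr_gt0 //.
    by rewrite mulVf // gt_eqF.
  have [p [n [pp pn sE nk]]] := pos_decomp (ps k0).
  have := Fs k0; rewrite sE (scalarfD Fl) (scalarfB Fl) (pf_scalar pF) F1.
  have := Fqn n; have := Fp _ ((positive_emb p).1 pp).
  have : (1 - e) * rn n <= (1 - e) * complex.Re (s k0).2 by exact: ler_wpM2l.
  have : 0 < e * complex.Re (s k0).2 by exact: mulr_gt0.
  lra.
exists (complexify F); split; last by move=> k; rewrite ext_complexify.
split=> // g h t sg sh t01 gh.
have gF z : F z = t * ext g z + (1 - t) * ext h z.
  rewrite -{1}(ext_complexify pF F1) /ext gh raddfD /= !Re_real; lra.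
have [t0 t1] : 0 < t /\ 0 < 1 - t by move: t01 => /andP[]; split; lra.
(* Both states in a convex decomposition of F are nonnegative at s_k, hence vanish there and satisfy
   the constraints. *)
have dom f u g' : 0 < u -> 0 < 1 - u -> state f -> state g' ->
    (forall z, F z = u * ext f z + (1 - u) * ext g' z) -> dominated K (ext f).
  move=> u0 u1 fs gs fE; have [fl fp fa] := ext_positive fs.
  have [_ gp _] := ext_positive gs.
  have fs0 k : ext f (s k) = 0.
    have := fE (s k); rewrite Fs => e.
    have : 0 <= u * ext f (s k) by rewrite mulr_ge0 ?fp // ltW.
    have : 0 <= (1 - u) * ext g' (s k) by rewrite mulr_ge0 ?gp // ltW.
    move=> h1 h2; have /eqP : u * ext f (s k) = 0 by lra.
    by rewrite mulf_eq0 gt_eqF //= => /eqP.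
  split; first exact: ext_positive.
  move=> y c [k [v [/= v0 pk]]] _; have := fp _ pk.
  rewrite (scalarfB fl) (scalarfD fl) !(scalarfZ fl) fs0 (ext1 fs); lra.
have dg : dominated K (ext g) by exact: (dom g t h).
have dh : dominated K (ext h).
  apply: (dom h (1 - t) g) => //; first by rewrite opprB addrC subrK.
  by move=> z; rewrite gF; ring.
have [eg eh] := Fext _ _ _ dg dh t01 gF.
by split; [rewrite -eg|rewrite -eh]; rewrite complexify_ext //; [case: sg|case: sh].
Qed.

Section Annihilator.
Context (n : unitz C).
Hypothesis sn : adj n = n.

Let ann : set C := [set d | emb d * n = 0 /\ n * emb d = 0].

Let ann0 : ann 0.
Proof. by split; rewrite emb0 ?mul0r ?mulr0. Qed.

Let annD (x y : C) : ann x -> ann y -> ann (x + y).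
Proof. by move=> [xn nx] [yn ny]; split; rewrite embD ?mulrDl ?mulrDr ?xn ?nx ?yn ?ny addr0. Qed.

Let embZr (c : R[i]) x (z : unitz C) : emb x * z = 0 -> emb (c *: x) * z = 0.
Proof. by move=> h; rewrite embC mulrDl -!scalerAl embi -mulrA h mulr0 !scaler0 addr0. Qed.

Let embZl (c : R[i]) x (z : unitz C) : z * emb x = 0 -> z * emb (c *: x) = 0.
Proof.
move=> h; rewrite embC mulrDr -!scalerAr embi iiC mulrA h mul0r !scaler0.
by rewrite addr0.
Qed.

Let annZ (c : R[i]) x : ann x -> ann (c *: x).
Proof. by move=> [xn nx]; split; [exact: embZr|exact: embZl]. Qed.

Let annM (x y : C) : ann x -> ann y -> ann (x ** y).
Proof. by move=> [xn nx] [yn ny]; split; rewrite embM -?mulrA ?yn ?mulr0 // mulrA nx mul0r. Qed.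

Let annS x : ann x -> ann (star x).
Proof.
by move=> [xn nx]; split; rewrite emb_star -sn -adjM ?nx ?xn adj0.
Qed.

Let ann_closed : closed ann.
Proof.
move=> x clx.
have near e : 0 < e -> exists2 d, ann d & nrm (emb x - emb d) < e.
  move=> e0; have [|d [ad]] := clx (ball x e%:C).
    by apply: nbhsx_ballx; rewrite ltcR.
  rewrite -ball_normE /= rnE ltcR => h; exists d => //.
  by rewrite -embB nrm_emb.
split; apply: (@nrm_small _ _ _ (nrm n)) => e /near[d [dn nd] h].
  have -> : emb x * n = (emb x - emb d) * n by rewrite mulrBl dn subr0.
  by apply: (le_trans (nrmM _ _)); rewrite mulrC ler_wpM2l ?nrm_ge0 // ltW.
have -> : n * emb x = n * (emb x - emb d) by rewrite mulrBr nd subr0.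
by apply: (le_trans (nrmM _ _)); rewrite ler_wpM2l ?nrm_ge0 // ltW.
Qed.

Definition annihilator : csubalg C :=
  CSubalg ann0 annD annZ annM annS ann_closed.

(** For 0 <= a <= d one gets 0 <= nan <= ndn = 0, so the root r of a satisfies rn = 0. *)
Lemma annihilator_hereditary : hereditary annihilator.
Proof.
move=> a d [dn nd] /positive_emb pa /positive_emb; rewrite embB => /(pos_conj_sa sn).
rewrite mulrBr mulrBl nd mul0r sub0r => h.
have nan : n * emb a * n = 0 by apply: pos_anti => //; exact: pos_conj_sa.
have [r [/pos_adj sr ra _]] := pos_sqrt pa.
have rn0 : r * n = 0.
  by apply: adjM_eq0; rewrite adjM sr sn -mulrA (mulrA r r) ra mulrA.
have an : emb a * n = 0 by rewrite -ra -mulrA rn0 mulr0.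
split=> //; have := congr1 adj an.
by rewrite adjM sn adj0 (pos_adj pa).
Qed.

End Annihilator.

End Faces.

(** * The almost extension property implies aperiodicity *)

Section Truncation.
Context (R : realType) (C : cstarAlgType R).
Implicit Types (b d p : C) (m : unitz C).

(** The positive part of b - t has a nonnegative scalar part that equals the one of [m] minus t and
    has product 0 with it; so it is 0, and the positive part lies in C. *)
Lemma truncation b t : star b = b -> 0 < t -> exists p m,
  [/\ positive p, pos m, emb b - t%:A = emb p - m,
      emb p * m = 0 /\ m * emb p = 0 & t <= complex.Re m.2].
Proof.
move=> sb t0; have [|p [m [pp pm bE pm0 mp0]]] := @jordan _ _ (emb b - t%:A).
  by rewrite adjB adjA star_emb.
have e : p.2 = m.2 - t%:C.
  by move/(congr1 snd): bE => /= h; rewrite -[LHS](subrK m.2) -h mulr1 sub0r addrC.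
have p2 : p.2 = 0.
  move/(congr1 snd): mp0 => /= /eqP; rewrite mulf_eq0 => /orP[/eqP m0|/eqP//].
  have := pos_snd pp; rewrite e m0 sub0r oppr_ge0 lecR leNgt.
  by rewrite t0.
rewrite (emb_eq p2) in pp bE pm0 mp0.
exists p.1, m; split => //; first exact/positive_emb.
by move: e; rewrite p2 => /esym/(congr1 (@complex.Re R)) /=; rewrite raddfB /=; lra.
Qed.

Lemma truncation_neq0 b t p m : positive b -> 0 <= t -> t < rn b -> pos m ->
  emb b - t%:A = emb p - m -> p != 0.
Proof.
move=> /positive_emb pb t0 tb pm bE; apply/eqP => p0.
suff : nrm (emb b) <= t by rewrite nrm_emb leNgt tb.
apply: nrm_le_pos => //.
by rewrite -opprB bE p0 emb0 sub0r opprK.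
Qed.

(** A pure state vanishing on the negative part of d - t has phi(d) - t = phi(p) >= 0. *)
Lemma pure_state_peak d t : positive d -> 0 < t -> t < rn d ->
  exists2 phi : C -> R[i], pure_state phi & t <= complex.Re (phi d).
Proof.
move=> pd t0 td; have ped := (positive_emb d).1 pd.
have sd : star d = d by apply: emb_inj; rewrite emb_star pos_adj.
have [p [m [pp pm dE [pm0 mp0] mt]]] := truncation sd t0.
have p_neq0 := truncation_neq0 pd (ltW t0) td pm dE.
have [||||phi [pphi phim]] := @pure_state_on_face _ C (fun=> m).
- by [].
- by move=> _; rewrite subrr; exact: pos0.
- by move=> _; exists (emb p) => //; apply: contra_neq p_neq0 => /emb_inj.
- by exists 0%N; lra.
move/(_ 0%N) in phim; exists phi => //; have [ps _] := pphi; have [el ep _] := ext_positive ps.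
have := congr1 (ext phi) dE; rewrite !(scalarfB el) phim (scalarfZ el) (ext1 ps).
rewrite !ext_emb; have := ep _ ((positive_emb p).1 pp); rewrite ext_emb; lra.
Qed.

End Truncation.

Section AlmostExtensionAperiodic.
Context (R : realType) (B : cstarAlgType R) (A : csubalg B).
Local Notation incl := (@csub_incl R B A).
Implicit Types (y z w : unitz A).

(* The two bounds come from the extensions of [phi] whose value at [X] is largest
   and smallest; by uniqueness these coincide. *)
Lemma unique_squeeze (phi : A -> R[i]) (X : unitz B) e :
  unique_ext_pure_state phi -> 0 < e ->
  exists w z, [/\ pos z, ext phi z < e, pos (umap w - re X) &
    pos (umap z - (umap w - re X))].
Proof.
move=> [[ps _] [g [_ guniq]]] e0; have e2 : 0 < e / 2 by rewrite divr_gt0.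
have [psi1 [s1 x1 h1]] := state_extension X ps.
have [psi2 [s2 x2 h2]] := state_extension (- X) ps.
have e12 : psi2 = psi1 by rewrite -(guniq psi1) // -(guniq psi2).
have [w [pw we]] := h1 _ e2; have [v [pv ve]] := h2 _ e2.
have [el ep _] := ext_positive ps; have [gl _ _] := ext_positive s1.
(* w lies above re X with phi(w) < psi(X) + e/2, and v above -re X with phi(v) < -psi(X) + e/2; so w
   + v is positive of value below e. *)
have uE : umap (w + v) - (umap w - re X) = umap v - re (- X).
  by rewrite umapD reN opprB opprK addrC addrA subrK addrC.
exists w, (w + v); split => //.
- apply/pos_umap; rewrite -(subrK (umap w - re X) (umap _)) uE; exact: posD.
- by rewrite (scalarfD el); move: ve; rewrite e12 (scalarfN gl); lra.
- by rewrite uE.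
Qed.

Lemma re_decomp (X : unitz B) : X = re X - ii * re (ii * X).
Proof.
rewrite /re adjM adj_ii mulrN -[adj X * ii]iiC -scalerAr -mulrBr mulrA iiii.
rewrite mulN1r scalerN opprK -scalerDr addrACA subrr addr0.
by rewrite -mulr2n -[X *+ 2]scaler_nat scalerA mulVf ?pnatr_eq0 // scale1r.
Qed.

(** h is the function max(0, 1 - s/sigma) of z, obtained as p/sigma with p the positive part of
    sigma - z. *)
Lemma damping z sigma : pos z -> 0 < sigma -> exists h : unitz A,
  [/\ pos h, pos (1 - h), nrm (h * z * h) <= sigma &
    pos (sigma^-1 *: z - (1 - h))].
Proof.
move=> pz s0; have sz := pos_adj pz.
have [|p [n [pp pn zE pn0 np0]]] := @jordan _ _ (sigma%:A - z).
  by rewrite adjB adjA sz.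
have sp := pos_adj pp.
have ps : nrm p <= sigma.
  by apply: (nrm_pospart pp pn pn0 np0 (ltW s0)); rewrite -zE subKr.
have si : 0 < sigma^-1 by rewrite invr_gt0.
have zE' : z = sigma%:A - p + n by rewrite -[LHS](subKr sigma%:A) zE opprB addrA [RHS]addrAC.
exists (sigma^-1 *: p); split.
- by apply: posZ => //; exact: ltW.
- rewrite -[1](scale1r 1); apply: pos_ubound; first by rewrite adjZ sp.
  by rewrite nrmZ gtr0_norm // mulrC ler_pdivrMr // mul1r.
- rewrite -!scalerAl -scalerAr nrmZ nrmZ gtr0_norm // mulrA.
  (* The difference is p^3, so pzp <= sigma p^2. *)
  have h1 : pos (sigma *: (p * p) - p * z * p).
    have -> : sigma *: (p * p) - p * z * p = p * p * p.
      rewrite zE' mulrDr mulrBr pn0 addr0 -scalerAr mulr1 mulrBl -scalerAl.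
      by rewrite subKr.
    exact: pos_conj_sa.
  have := nrm_mono (pos_conj_sa sp pz) h1.
  rewrite nrmZ nrm_sqr // gtr0_norm // => h2.
  have h3 : nrm p ^+ 2 <= sigma ^+ 2 by rewrite ler_pXn2r ?nnegrE ?nrm_ge0 // ltW.
  have h4 : nrm (p * z * p) <= sigma * sigma ^+ 2.
    by apply: (le_trans h2); rewrite ler_wpM2l // ltW.
  by rewrite -invfM mulrC ler_pdivrMr ?mulr_gt0.
- have -> : sigma^-1 *: z - (1 - sigma^-1 *: p) = sigma^-1 *: n.
    have -> : 1 = sigma^-1 *: (sigma%:A) :> unitz A.
      by rewrite scalerA mulVf ?scale1r // gt_eqF.
    by rewrite -!scalerBr zE' [_ + n]addrC addrK.
  by apply: posZ => //; exact: ltW.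
Qed.

(** Since phi((1 - h)d)^2 <= phi(d^2) phi(1 - h) <= 1/64, phi(hd) >= 1/4 - 1/8. Hence d h^2 d, which
    is below dhd, has norm nrm(hd)^2 >= 1/64. *)
Lemma damped_norm (phi : A -> R[i]) (d : A) (h : unitz A) : state phi ->
  positive d -> rn d = 1 -> 4^-1 <= complex.Re (phi d) -> pos h -> pos (1 - h) ->
  ext phi (1 - h) <= 64^-1 -> 64^-1 <= nrm (emb d * h * emb d).
Proof.
move=> ps /positive_emb pd d1 pd4 ph ph1 h64.
have pe := ext_positive ps; have [el ep _] := pe; have sd := pos_adj pd.
have sh := pos_adj ph.
have hh : pos (emb d * (h * h) * emb d).
  by apply: pos_conj_sa => //; exact: pos_sqr.
have hmono : nrm (emb d * (h * h) * emb d) <= nrm (emb d * h * emb d).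
  apply: nrm_mono => //; rewrite -mulrBl -mulrBr; apply: pos_conj_sa => //.
  rewrite -{1}[h]mulr1 -mulrBr; apply: posM => //.
  by apply: commrB; [exact: commr1|exact: commr_refl].
apply: le_trans hmono.
have -> : emb d * (h * h) * emb d = adj (h * emb d) * (h * emb d).
  by rewrite adjM sh sd !mulrA.
rewrite nrm_adjM.
have := pf_le pe (h * emb d); rewrite (ext1 ps) mulr1.
have := pf_compl pe (emb d) ph ph1; rewrite mulrBl mul1r (scalarfB el) ext_emb sd.
have : ext phi (emb d * emb d) <= 1.
  by apply: (le_trans (pf_le pe _)); rewrite (ext1 ps) mulr1 nrm_sqr // nrm_emb d1 expr1n.
have := ep _ ph1; have := ep _ (pos_sqr sd).
move: pd4 h64.
set u := complex.Re (phi d); set v := ext phi (h * emb d); set k := ext phi (1 - h).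
set q := ext phi (emb d * emb d); set N := nrm _.
move=> u4 k64 q0 k0 q1 uv vN.
have qk : q * k <= 64^-1.
  apply: (@le_trans _ _ (1 * 64^-1)); last by rewrite mul1r.
  by apply: ler_pM.
have uv8 : u - v <= 8^-1.
  rewrite leNgt; apply/negP => h8.
  have : 8^-1 ^+ 2 < (u - v) ^+ 2 by rewrite ltr_pXn2r ?nnegrE //; lra.
  have : (8^-1 : R) ^+ 2 = 64^-1 by field.
  lra.
have N8 : 8^-1 <= N by lra.
have : 8^-1 ^+ 2 <= N ^+ 2 by rewrite ler_pXn2r ?nnegrE //; lra.
have : (8^-1 : R) ^+ 2 = 64^-1 by field.
lra.
Qed.

End AlmostExtensionAperiodic.

(** * Pointwise closure through finite lists of elements *)

Section PointwiseClosure.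
Context (R : realType) (C : cstarAlgType R) (S : set (C -> R[i])).
Implicit Type phi : C -> R[i].

Lemma complex_ball (l : R[i]) (r : R) : 0 < r ->
  nbhs (l : R[i]^o) [set m : R[i]^o | cmod (m - l) < r].
Proof.
move=> r0; have h : nbhs (l : R[i]^o) (ball (l : R[i]^o) r%:C).
  by apply: nbhsx_ballx; rewrite ltcR.
apply: filterS h => m.
by rewrite -ball_normE /= distrC (rnE (m - l : R[i]^o)) ltcR.
Qed.

Lemma complex_ball_inv (l : R[i]) (W : set R[i]^o) : nbhs (l : R[i]^o) W ->
  exists2 r : R, 0 < r & [set m | cmod (m - l) < r] `<=` W.
Proof.
move=> /nbhs_ballP[e /= e0 h].
have eE : e = (complex.Re e)%:C by rewrite RRe_real // gtr0_real.
exists (complex.Re e); first by rewrite -ltcR -eE.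
move=> m hm; apply: h; rewrite -ball_normE /= distrC.
by rewrite eE (rnE (m - l : R[i]^o)) ltcR.
Qed.

Lemma closure_ptws_near phi (d : C) r : closure (S : set {ptws C -> R[i]^o}) phi ->
  0 < r -> exists2 f, S f & cmod (f d - phi d) < r.
Proof.
move=> cl r0; pose W : set {ptws C -> R[i]^o} := [set f | cmod (f d - phi d) < r].
have nW : nbhs (phi : {ptws C -> R[i]^o}) W.
  have [/(_ (fun x h => h)) h _] := @pointwise_cvgP C R[i]^o (nbhs (phi : {ptws C -> R[i]^o})) phi _.
  exact: (h d _ (complex_ball (phi d) r0)).
by have [f [Sf Wf]] := cl _ nW; exists f.
Qed.

(** The filter generated by closeness to phi on finite lists converges pointwise to phi, so it
    contains every neighbourhood of phi. *)
Lemma closure_ptws phi :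
  (forall (s : seq C) r, 0 < r ->
    exists2 f, S f & forall a, a \in s -> cmod (f a - phi a) < r) ->
  closure (S : set {ptws C -> R[i]^o}) phi.
Proof.
move=> h; pose F : set_system (C -> R[i]^o) := [set W | exists (s : seq C) r, 0 < r /\
  [set f | forall a, a \in s -> cmod (f a - phi a) < r] `<=` W].
have FF : Filter F.
  split; first by exists [::], 1.
    move=> P Q [s [r [r0 sP]]] [t [q [q0 tQ]]].
    exists (s ++ t), (Num.min r q); split; first by rewrite lt_min r0.
    move=> f hf; split; [apply: sP|apply: tQ] => a ain;
      have := hf a; rewrite mem_cat ain ?orbT lt_min => /(_ isT)/andP[] //.
  by move=> P Q PQ [s [r [r0 sP]]]; exists s, r; split => // f /sP /PQ.
have cF : F --> (phi : {ptws C -> R[i]^o}).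
  apply/(@pointwise_cvgP C R[i]^o F phi FF) => a W /complex_ball_inv[r r0 rW].
  exists [:: a], r; split => // f /(_ a (mem_head _ _)) hf.
  exact: rW.
move=> W /cF[s [r [r0 sW]]]; have [f Sf hf] := h s r r0.
by exists f; split => //; apply: sW.
Qed.

End PointwiseClosure.

Section AlmostExtensionAperiodic.
Context (R : realType) (B : cstarAlgType R) (A : csubalg B).
Local Notation incl := (@csub_incl R B A).

Lemma nrm_umap_pos (z : unitz A) : pos z -> nrm (umap z) <= nrm z.
Proof.
move=> pz; apply: nrm_le_pos; rewrite ?nrm_ge0 //; first exact: umap_pos.
by rewrite -(umap1 A) -umapZ -umapB; apply/umap_pos/pos_nrm/pos_adj.
Qed.

Lemma aep_aperiodic : almost_extension_property A -> aperiodic A.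
Proof.
move=> aep x D Dher [d0 Dd0 d0n] e e0.
pose d1 := star d0 ** d0.
have d1n : 0 < rn d1.
  rewrite rn_starM exprn_gt0 // lt_def rn_ge0 andbT.
  by apply: contra_neq d0n; exact: rn0_eq0.
have scale_pos (t : R) (a : A) : 0 < t -> positive a -> positive (t%:C *: a).
  by move=> t0 /positive_emb pa; apply/positive_emb; rewrite embZ; apply: posZ => //; exact: ltW.
have rnZr (t : R) (C : cstarAlgType R) (a : C) : 0 < t -> rn (t%:C *: a) = t * rn a.
  by move=> t0; rewrite rnZ -/(cmod _) cmodR gtr0_norm.
pose d : A := (rn d1)^-1%:C *: d1.
have pd : positive d by apply: scale_pos; [rewrite invr_gt0|exists d0].
have Dd : carrier D d by apply: csubZ; apply: csubM => //; exact: csubS.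
have dn : rn d = 1 by rewrite rnZr ?invr_gt0 // mulVf // gt_eqF.
have ped := (positive_emb d).1 pd; have sd := pos_adj ped.
(* A pure state with value at least 1/2 at [d]; a nearby one with unique extension still has value
   at least 1/4. *)
have [||psi ppsi psid] := @pure_state_peak R A d 2^-1 pd.
- by rewrite invr_gt0.
- by rewrite dn invf_lt1 // ltr1n.
have [|phi uphi phid] := @closure_ptws_near R A _ _ d 4^-1 (aep _ ppsi).
  by rewrite invr_gt0.
have [[ps _] _] := uphi.
have phid4 : 4^-1 <= complex.Re (phi d).
  have := cmod_Re (phi d - psi d); rewrite raddfB /= ler_norml => /andP[+ _].
  by move: phid psid; clear; lra.
(* Normalising [b] costs a factor of at most 64^2, so the error 2 sg becomes e/2. The bounds sg/128
   on phi(z1) and phi(z2) give phi(1 - h) <= 1/64. *)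
pose sg := e / 4 / 64 / 64; have sg0 : 0 < sg by rewrite !divr_gt0.
have et0 : 0 < sg / 128 by rewrite divr_gt0.
pose D' : unitz B := emb (incl d); pose X := D' * emb x * D'.
(* [X] need not be self-adjoint: [ii * X] supplies its imaginary part. *)
have [w1 [z1 [pz1 ez1 pT1 pz1T]]] := unique_squeeze X uphi et0.
have [w2 [z2 [pz2 ez2 pT2 pz2T]]] := unique_squeeze (ii * X) uphi et0.
have [el ep _] := ext_positive ps.
have [h [ph ph1 hz hs]] := damping (posD pz1 pz2) sg0.
have h64 : ext phi (1 - h) <= 64^-1.
  have := ep _ hs; rewrite (scalarfB el) (scalarfZ el) subr_ge0 => /le_trans; apply.
  rewrite mulrC ler_pdivrMr // (scalarfD el); move: ez1 ez2; clear; lra.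
(* A product with a factor from A has scalar part 0, hence lies in A. *)
have [b bE] : exists b : A, emb b = emb d * h * emb d.
  by exists (emb d * h * emb d).1; apply/esym/emb_eq; rewrite /= mulr0.
have pb : positive b by apply/positive_emb; rewrite bE; exact: pos_conj_sa.
have Db : carrier D b.
  apply: (Dher b (d ** d)) => //; first exact: csubM.
  apply/positive_emb; rewrite embB embM bE.
  have -> : emb d * emb d - emb d * h * emb d = emb d * (1 - h) * emb d.
    by rewrite mulrBr mulr1 mulrBl.
  exact: pos_conj_sa.
have b64 : 64^-1 <= rn b.
  by rewrite -nrm_emb bE; exact: damped_norm h64.
have b0 : 0 < rn b by apply: lt_le_trans b64; rewrite invr_gt0.
pose U := umap h; have sh : adj h = h := pos_adj ph.
have sU : adj U = U by rewrite -umap_adj sh.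
pose Y := emb d * (h * (w1 - ii * w2) * h) * emb d.
have [y YE] : exists y : A, emb y = Y.
  by exists Y.1; apply/esym/emb_eq; rewrite /= mulr0.
(* T <= z <= z1 + z2, so compressing by h leaves T dominated by the damped z1 + z2. *)
have nT (T : unitz B) z : pos T -> pos (umap z - T) -> pos (z1 + z2 - z) ->
    nrm (U * T * U) <= sg.
  move=> pT pzT pzz; apply: le_trans hz; apply: le_trans (nrm_umap_pos _); last first.
    by apply: pos_conj_sa => //; exact: posD.
  apply: nrm_mono; first exact: pos_conj_sa.
  rewrite !umapM -/U -mulrBl -mulrBr; apply: pos_conj_sa => //.
  have := posD (umap_pos pzz) pzT.
  by rewrite umapB addrA subrK.
have n1 : nrm (U * (umap w1 - re X) * U) <= sg.
  by apply: (nT _ z1) => //; rewrite addrAC subrr add0r.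
have n2 : nrm (U * (umap w2 - re (ii * X)) * U) <= sg.
  by apply: (nT _ z2) => //; rewrite addrK.
have bxb : rn (incl b ** x ** incl b - incl y) <= sg + sg.
  rewrite -nrm_emb embB !embM -!umap_emb bE YE !umapM -/U !umap_emb -/D'.
  have -> : D' * U * D' * emb x * (D' * U * D') -
      D' * (U * umap (w1 - ii * w2) * U) * D' =
      D' * (U * (X - umap (w1 - ii * w2)) * U) * D'.
    by rewrite !(mulrBr, mulrBl) /X !mulrA.
  have -> : X - umap (w1 - ii * w2) =
      - (umap w1 - re X) + ii * (umap w2 - re (ii * X)).
    rewrite {1}(re_decomp X) umapB umapM mulrBr !opprB.
    rewrite -[umap ii]/(ii : unitz B).
    by rewrite addrACA [RHS]addrACA; congr (_ + _); exact: addrC.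
  have D1 : nrm D' = 1 by rewrite nrm_emb.
  apply: (le_trans (nrmM _ _)); rewrite D1 mulr1.
  apply: (le_trans (nrmM _ _)); rewrite D1 mul1r.
  rewrite mulrDr mulrDl; apply: (le_trans (nrmD _ _)); apply: lerD.
    by rewrite mulrN mulNr nrmN.
  by rewrite [U * (ii * _)]mulrA -iiC -mulrA -mulrA nrm_ii mulrA.
pose c := (rn b)^-1; have c0 : 0 < c by rewrite invr_gt0.
have c64 : c <= 64 by rewrite /c -[leRHS]invrK lef_pV2 ?posrE ?invr_gt0.
exists (c%:C *: b), ((c * c)%:C *: y); split.
- exact: csubZ.
- exact: scale_pos.
- by rewrite rnE rnZr // mulVf // gt_eqF.
rewrite !inclZ cmulZl cmulZl cmulZr scalerA -rmorphM /= -scalerBr rnE ltcR rnZr ?mulr_gt0 //.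
have cc : c * c <= 64 * 64 by apply: ler_pM => //; exact: ltW.
apply: (@le_lt_trans _ _ (64 * 64 * (sg + sg))).
  by apply: ler_pM => //; [rewrite mulr_ge0 // ltW|exact: rn_ge0].
have -> : 64 * 64 * (sg + sg) = e / 2 by rewrite /sg; field.
by move: e0; clear; lra.
Qed.

End AlmostExtensionAperiodic.

(** * Aperiodicity implies the almost extension property *)

Section PureNeighbourhoods.
Context (R : realType) (C : cstarAlgType R).
Implicit Types (phi : C -> R[i]) (z n : unitz C) (a : C).

Lemma ideal_emb a z : exists b : C, emb b = emb a * z.
Proof. by exists (emb a * z).1; apply/esym/emb_eq; rewrite /= mul0r. Qed.

(** As z = [adj (1 - emb a) * z], Cauchy-Schwarz bounds phi(z)^2 by phi(z^2) times a factor below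
    2e, for a in the unit ball with Re phi(a) > 1 - e. *)
Lemma state_annihilated phi z : state phi -> adj z = z ->
  (forall a, emb a * z = 0) -> ext phi z = 0.
Proof.
move=> ps sz az; have pe := ext_positive ps; have [el ep ea] := pe.
set q := ext phi z; pose N := ext phi (z * z).
have N0 : 0 <= N by apply/ep/pos_sqr.
have qe e : 0 < e -> q ^+ 2 <= N * (2 * e).
  move=> e0; have [a a1 ha] := state_sup ps e0.
  have := pf_cauchy_schwarz pe z (1 - emb a); rewrite sz -/N.
  have -> : adj (1 - emb a) * z = z by rewrite adjB adj1 -emb_star mulrBl mul1r az subr0.
  move=> /le_trans; apply; rewrite ler_wpM2l //.
  have -> : ext phi (adj (1 - emb a) * (1 - emb a)) =
      1 - 2 * complex.Re (phi a) + ext phi (adj (emb a) * emb a).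
    rewrite adjB adj1 mulrBl mulrBr mul1r mulrBr mulr1 !(scalarfB el) (ext1 ps) ea.
    by rewrite mul1r !ext_emb; ring.
  have : ext phi (adj (emb a) * emb a) <= 1.
    apply: (le_trans (pf_le pe _)); rewrite (ext1 ps) mulr1 nrm_adjM nrm_emb.
    by rewrite expr_le1 ?rn_ge0.
  by move: ha; clear; lra.
apply/eqP; rewrite -sqrf_eq0; apply/eqP/le_anti; rewrite sqr_ge0 andbT.
apply/ler_addgt0Pr => e e0; rewrite add0r.
have N1 : 0 < 2 * (N + 1) by move: N0; clear; lra.
apply: (le_trans (qe (e / (2 * (N + 1))) _)); first exact: divr_gt0.
have -> : N * (2 * (e / (2 * (N + 1)))) = e * (N / (N + 1)).
  by field; move: N0; clear; lra.
rewrite ger_pMr // ler_pdivrMr; move: N0; clear; lra.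
Qed.

(** Take h above all [v a] and [- v a] with phi(h) < d, and n the positive part of h - d. A state f
    vanishing at n has f(h) <= d, which bounds f - phi on the list. *)
Lemma pure_state_face_nbhs phi (s : seq C) r : pure_state phi -> 0 < r ->
  exists n, [/\ pos n, exists2 a : C, a != 0 & emb a * n = 0 &
    forall f, state f -> ext f n = 0 -> forall a, a \in s -> cmod (f a - phi a) < r].
Proof.
move=> /[dup] pphi [ps _] r0; have [el ep ea] := ext_positive ps.
(* Real parts at ia control imaginary parts at a; two bounds of r/4 sum to r/2. *)
pose s' := s ++ [seq 'i%C *: a | a <- s].
pose v (a : C) : unitz C := re (emb a) - (complex.Re (phi a))%:A.
have sv a : adj (v a) = v a by rewrite adjB re_adj adjA.
have extv f a : state f -> ext f (v a) = complex.Re (f a) - complex.Re (phi a).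
  move=> fs; have pf := ext_positive fs; have [fl _ _] := pf.
  by rewrite (scalarfB fl) (pf_re pf) (scalarfZ fl) (ext1 fs) mulr1 ext_emb.
pose d := r / 4; have d0 : 0 < d by rewrite divr_gt0.
have [|h [ph hys hd]] :=
    @pure_sup_seq R C phi ([seq v a | a <- s'] ++ [seq - v a | a <- s']) d pphi _ d0.
  move=> y; rewrite mem_cat => /orP[] /mapP[a _ ->].
    by rewrite sv extv // subrr.
  by rewrite adjN sv (scalarfN el) extv // subrr oppr0.
have sh := pos_adj ph.
have [|p [n [pp pn dE pn0 np0]]] := @jordan _ _ (d%:A - h).
  by rewrite adjB adjA sh.
have sp := pos_adj pp.
exists n; split => //.
(* phi(p) = d - phi(h) + phi(n) > 0, so some ap is nonzero; it lies in C and kills n. *)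
- apply: contrapT => no.
  have : ext phi p = 0.
    apply: state_annihilated => // a; have [b bE] := ideal_emb a p.
    have [b0|b0] := eqVneq b 0; first by rewrite -bE b0.
    by exfalso; apply: no; exists b => //; rewrite bE -mulrA pn0 mulr0.
  have := congr1 (ext phi) dE; rewrite !(scalarfB el) (scalarfZ el) (ext1 ps).
  by have := ep _ pn; move: hd; clear; lra.
move=> f fs fn a ain; have pf := ext_positive fs; have [fl fp _] := pf.
have fh : ext f h <= d.
  have := congr1 (ext f) dE; rewrite !(scalarfB fl) (scalarfZ fl) (ext1 fs) fn.
  by have := fp _ pp; clear; lra.
have close b : b \in s' -> `|complex.Re (f b - phi b)| <= d.
  move=> bs; rewrite raddfB /= ler_norml -extv //; apply/andP; split.
    rewrite lerNl -(scalarfN fl); apply: le_trans fh; apply: (pf_mono pf).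
    by apply: hys; rewrite mem_cat; apply/orP; right; apply/mapP; exists b.
  apply: le_trans fh; apply: (pf_mono pf); apply: hys.
  by rewrite mem_cat; apply/orP; left; apply/mapP; exists b.
have h1 : `|complex.Re (f a - phi a)| <= d by apply: close; rewrite mem_cat ain.
have h2 : `|complex.Im (f a - phi a)| <= d.
  have : 'i%C *: a \in s' by rewrite mem_cat; apply/orP; right; apply/mapP; exists a.
  move=> /close.
  have [fl' _ _] := fs; have [phl _ _] := ps.
  by rewrite (scalarfZ fl') (scalarfZ phl) -mulrBr (mulrC 'i%C) ReiNIm normrN.
apply: (le_lt_trans (cmod_le _)); move: h1 h2 r0; rewrite /d; clear; lra.
Qed.

End PureNeighbourhoods.

Section AperiodicAlmostExtension.
Context (R : realType) (B : cstarAlgType R) (A : csubalg B).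
Local Notation incl := (@csub_incl R B A).

(** x - bxb = (1 - b)x + bx(1 - b). Each term has value at most Md by [pf_compl], as psi(1 - b) <=
    d^2; the second is treated through its adjoint. *)
Lemma compression_bound (psi : B -> R[i]) (x b y : B) (M d : R) : state psi ->
  positive b -> rn b = 1 -> 1 - d ^+ 2 <= complex.Re (psi b) -> rn x <= M -> 0 < d ->
  rn (b ** x ** b - y) < d ->
  `|complex.Re (psi x) - complex.Re (psi y)| <= 2 * M * d + d.
Proof.
move=> ps /positive_emb pb b1 bd xM d0 bxy.
have pe := ext_positive ps; have [el ep ea] := pe; have sb := pos_adj pb.
have M0 : 0 <= M by exact: le_trans (rn_ge0 _) xM.
have pb1 : pos (1 - emb b).
  by rewrite -[1]scale1r; apply: pos_ubound; rewrite ?nrm_emb ?b1.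
have d1 : ext psi (1 - emb b) <= d ^+ 2.
  by rewrite (scalarfB el) (ext1 ps) ext_emb; move: bd; clear; lra.
have key z : nrm z <= M -> `|ext psi ((1 - emb b) * z)| <= M * d.
  move=> zM; have := pf_compl pe z pb pb1.
  have zz : ext psi (adj z * z) <= M ^+ 2.
    apply: (le_trans (pf_le pe _)); rewrite (ext1 ps) mulr1 nrm_adjM.
    by rewrite ler_pXn2r ?nnegrE ?nrm_ge0.
  have h : ext psi (adj z * z) * ext psi (1 - emb b) <= (M * d) ^+ 2.
    rewrite exprMn; apply: ler_pM => //; [exact/ep/pos_adjM|exact: ep].
  move=> /le_trans/(_ h); rewrite -[_ ^+ 2 in X in X -> _]real_normK ?num_real //.
  by rewrite ler_pXn2r ?nnegrE // mulr_ge0 // ltW.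
have k1 : `|ext psi ((1 - emb b) * emb x)| <= M * d by apply: key; rewrite nrm_emb.
have k2 : `|ext psi ((1 - emb b) * (adj (emb x) * emb b))| <= M * d.
  apply: key; apply: (le_trans (nrmM _ _)); rewrite nrm_adj !nrm_emb b1.
  by rewrite mulr1.
have k2' : ext psi ((1 - emb b) * (adj (emb x) * emb b)) =
           ext psi (emb b * emb x * (1 - emb b)).
  by rewrite -ea !adjM adjK sb (pos_adj pb1).
have dec : emb x - emb (b ** x ** b) = (1 - emb b) * emb x + emb b * emb x * (1 - emb b).
  by rewrite !embM mulrBl mulrBr mul1r mulr1 addrA subrK.
have k3 : `|ext psi (emb (b ** x ** b - y))| <= d.
  rewrite ext_emb; apply: (le_trans (cmod_Re _)); apply: (le_trans (state_bound _ ps)).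
  exact: ltW.
have -> : complex.Re (psi x) - complex.Re (psi y) =
    ext psi ((1 - emb b) * emb x) + ext psi (emb b * emb x * (1 - emb b)) +
    ext psi (emb (b ** x ** b - y)).
  by rewrite -(scalarfD el) -dec embB !(scalarfB el) addrA subrK !ext_emb.
rewrite k2' in k2; apply: (le_trans (ler_normD _ _)); apply: lerD => //.
apply: (le_trans (ler_normD _ _)); move: k1 k2; clear; lra.
Qed.

(** Aperiodicity in the annihilator of s yields b. With p and m the positive and negative parts of b
    - (1 - e), take s' = s + m; p is nonzero since b has norm 1. *)
Lemma aperiodic_step (s : unitz A) (x : B) (e : R) : aperiodic A -> pos s ->
  (exists2 a : A, a != 0 & emb a * s = 0) -> 0 < e < 1 ->
  exists s' : unitz A, [/\ pos (s' - s), 0 < complex.Re s'.2,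
    exists2 p : A, p != 0 & emb p * s' = 0 &
    exists b y : A, [/\ positive b, rn b = 1, pos (emb b - ((1 - e)%:A - s')) &
      rn (incl b ** x ** incl b - incl y) < e]].
Proof.
move=> aper ps [a a0 as0] /andP[e0 e1]; have ss := pos_adj ps.
have e1' : 0 < 1 - e by rewrite subr_gt0.
pose D := annihilator ss.
have [|b [y [Db pb b1 bxy]]] := aper x D (annihilator_hereditary (sn := ss)) _ e e0.
  exists (star a ** a); last first.
    apply: contra_neq a0 => aa; apply: rn0_eq0; apply/eqP.
    by rewrite -sqrf_eq0 -rn_starM aa rn0.
  have h : emb (star a ** a) * s = 0 by rewrite embM -mulrA as0 mulr0.
  split=> //; have := congr1 adj h.
  by rewrite adjM ss adj0 -emb_star starM starK.
have {}b1 : rn b = 1 by rewrite /rn b1.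
have {}bxy : rn (incl b ** x ** incl b - incl y) < e by rewrite -ltcR -rnE.
have peb := (positive_emb b).1 pb.
have sb : star b = b by apply: emb_inj; rewrite emb_star pos_adj.
have [p [m [pp pm bE [pm0 mp0] mt]]] := truncation sb e1'.
have p0 : p != 0.
  by apply: (truncation_neq0 pb (ltW e1') _ pm bE); rewrite b1 ltrBlDr ltrDl.
have pep := (positive_emb p).1 pp; have sp := pos_adj pep.
have [bs0 _] := Db.
(* From bs = 0, v = ps satisfies pv + (1 - e)v = 0; multiplying by [adj v] gives two positive terms
   with sum 0. *)
have ps0 : emb p * s = 0.
  pose v := emb p * s.
  have pbE : emb p * emb b = emb p * emb p + (1 - e) *: emb p.
    by rewrite -(subrK (1 - e)%:A (emb b)) bE mulrDr mulrBr pm0 subr0 -scalerAr mulr1.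
  have : emb p * v + (1 - e) *: v = 0.
    by rewrite /v mulrA scalerAl -mulrDl -pbE -mulrA bs0 mulr0.
  move=> /(congr1 (fun z => adj v * z)); rewrite mulr0 mulrDr mulrA -scalerAr => h.
  have vv : adj v * v = 0.
    apply: pos_anti; first exact: pos_adjM.
    have : pos ((1 - e)^-1 *: (adj v * emb p * v)).
      by apply: posZ; [rewrite invr_ge0 ltW|exact: pos_conj].
    move/eqP: h; rewrite addr_eq0 => /eqP ->.
    by rewrite scalerN scalerA mulVf ?scale1r // gt_eqF.
  exact: adjM_eq0 vv.
exists (s + m); split.
- by rewrite addrAC subrr add0r.
- have := pos_snd ps; rewrite lecE => /andP[_] /=; rewrite raddfD /=.
  by move: mt e1'; clear; lra.
- by exists p => //; rewrite mulrDr ps0 pm0 addr0.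
exists b, y; split => //.
have -> : emb b - ((1 - e)%:A - (s + m)) = emb p + s.
  by rewrite opprB addrCA bE addrC addrA addrAC subrK addrC.
exact: posD.
Qed.

Lemma aperiodic_aep : separable B -> aperiodic A -> almost_extension_property A.
Proof.
move=> [S cS dS] aper phi0 pphi0; apply: closure_ptws => s0 r r0.
have [n [pn nz nP]] := pure_state_face_nbhs s0 pphi0 r0.
have [ind indI] : exists f : B -> nat, {in S &, injective f} by exact/countable_injP.
(* Enumerates the dense set; indices that name no element get 0. *)
pose X j : B := xget 0 [set x | S x /\ ind x = j].
pose d k : R := k.+2%:R^-1.
have d0 k : 0 < d k by rewrite invr_gt0 ltr0n.
have d1 k : d k < 1 by rewrite invf_lt1 ?ltr1n ?ltr0n.
(* Stage i treats a pair of an element and a precision; since [pickle] reaches all pairs, each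
   element is treated at every precision. *)
pose idx i : nat * nat := odflt (0, 0)%N (unpickle i).
(* The witness carried along keeps the next annihilator nonzero and the final face nonempty. *)
pose T := {s : unitz A | pos s /\ exists2 a : A, a != 0 & emb a * s = 0}.
pose P i (s s' : T) := [/\ pos (sval s' - sval s), 0 < complex.Re (sval s').2 &
    exists b y : A, [/\ positive b, rn b = 1,
      pos (emb b - ((1 - d (idx i).2 ^+ 2)%:A - sval s')) &
      rn (incl b ** X (idx i).1 ** incl b - incl y) < d (idx i).2]].
have step i (s : T) : exists s' : T, P i s s'.
  case: s => s [ps sz].
  (* [compression_bound] wants psi(b) >= 1 - d^2, hence the precision d^2, which also gives its
     other bound as d^2 <= d. *)
  have e01 : 0 < d (idx i).2 ^+ 2 < 1.
    by rewrite exprn_gt0 //= expr_lt1 // ltW.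
  have [s' [ss' s'0 s'z [b [y [pb b1 bs' bxy]]]]] :=
    aperiodic_step (X (idx i).1) aper ps sz e01.
  have ps' : pos s' by rewrite -(subrK s s'); exact: posD.
  exists (exist _ s' (conj ps' s'z)); split => //.
  exists b, y; split => //; apply: (lt_le_trans bxy).
  by rewrite expr2 ler_piMr // ltW.
have [next nextP] := choice (fun is0 : nat * T => step is0.1 is0.2).
pose sq := fix sq k : T := if k is m.+1 then next (m, sq m) else exist _ n (conj pn nz).
have sqP k : P k (sq k) (sq k.+1) by exact: (nextP (k, sq k)).
have [||||phi [pphi phis]] := @pure_state_on_face R A (fun k => sval (sq k)).
- by move=> k; case: (svalP (sq k)).
- by move=> k; case: (sqP k).
- move=> k; case: (svalP (sq k)) => _ [a a0 as0]; exists (emb a) => //.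
  by apply: contra_neq a0; exact: emb_inj.
(* The scalar part is known to be positive from the first step on; for [n] it is not. *)
- by exists 1%N; case: (sqP 0%N).
exists phi; last by have [ps _] := pphi; exact: nP ps (phis 0%N).
have [ps _] := pphi; split => //.
have [psi [spsi psiphi _]] := state_extension 0 ps.
exists psi; split=> // psi' [spsi' psi'phi].
apply: state_eq => // x.
have [el ep _] := ext_positive ps.
(* One error e for replacing x by x' and one for comparing with phi(y), under each of the two
   extensions. *)
suff close e : 0 < e -> `|complex.Re (psi x) - complex.Re (psi' x)| <= 4 * e.
  apply/eqP; rewrite -subr_eq0 -normr_le0; apply/ler_addgt0Pr => e e0; rewrite add0r.
  by have := close (e / 4) (divr_gt0 e0 (ltr0Sn _ _)); move: e0; clear; lra.
move=> e0.
have [x' [xx' Sx']] : exists x', rn (x - x') < e /\ S x'.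
  have [|x' [bx' Sx']] := dS (ball x e%:C)^° _ (@open_interior _ _).
    by exists x; apply: nbhsx_ballx; rewrite ltcR.
  exists x'; split => //; move: (interior_subset bx').
  by rewrite -ball_normE /= rnE ltcR.
(* K d_k is the error 2 M d_k + d_k of [compression_bound]. *)
pose M := rn x'; pose K := 2 * M + 1.
have K0 : 0 < K by have := rn_ge0 x'; rewrite /K /M; clear; lra.
have [k kK] : exists k, K * d k <= e.
  exists (Num.bound (K / e)); rewrite /d ler_pdivrMr ?ltr0n // mulrC -ler_pdivrMr //.
  have Ke0 : 0 <= K / e by rewrite divr_ge0 // ltW.
  by apply: (le_trans (ltW (archi_boundP Ke0))); rewrite ler_nat -addn2 leq_addr.
pose i := pickle (ind x', k).
have iE : idx i = (ind x', k) by rewrite /idx pickleK.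
have Xx' : X (ind x') = x'.
  have [SX indX] : [set z | S z /\ ind z = ind x'] (X (ind x')) by apply: xgetPex; exists x'.
  by apply: indI => //; exact: mem_set.
have [_ _ [b [y]]] := sqP i; rewrite iE /= Xx' => -[pb b1 bs bxy].
have phib : 1 - d k ^+ 2 <= complex.Re (phi b).
  have := ep _ bs; rewrite !(scalarfB el) (scalarfZ el) (ext1 ps) (phis i.+1) ext_emb.
  by clear; lra.
have pib : positive (incl b) by case: pb => c ->; exists (incl c).
have cb f : state f -> (forall a, f (incl a) = phi a) ->
    `|complex.Re (f x') - complex.Re (phi y)| <= e.
  move=> fs fphi; apply: le_trans kK; rewrite -fphi.
  have -> : K * d k = 2 * M * d k + d k by rewrite /K; ring.
  by apply: (compression_bound fs pib) => //; rewrite ?fphi.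
have xb f : state f -> `|complex.Re (f x) - complex.Re (f x')| <= e.
  move=> fs; have [fl _ _] := fs; rewrite -raddfB -(scalarfB fl).
  apply: (le_trans (cmod_Re _)); apply: (le_trans (state_bound _ fs)); exact: ltW.
have := cb _ spsi psiphi; have := cb _ spsi' psi'phi.
have := xb _ spsi; have := xb _ spsi'.
rewrite !ler_norml => /andP[? ?] /andP[? ?] /andP[? ?] /andP[? ?].
by apply/andP; split; lra.
Qed.

End AperiodicAlmostExtension.

Theorem theorem5p5 (R : realType) (B : cstarAlgType R) (A : csubalg B) :
  (almost_extension_property A -> aperiodic A) /\
  (separable B -> (aperiodic A <-> almost_extension_property A)).
Proof.
split; first exact: aep_aperiodic.
by move=> sB; split; [exact: aperiodic_aep|exact: aep_aperiodic].
Qed.
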